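(* Let $q\geqslant 2$ be a prime power. For every $\epsilon\in(0,q)$ and uniformly for complex $z$ with $|z|\leqslant q-\epsilon$, we have $$M_z(n):=\sum_{f\in\mathcal{M}_n}z^{\Omega(f)}=q^n n^{z-1}\left\{zH(z)+O_{\epsilon}\left(\frac1n\right)\right\},$$ where, for $|z|<q$, $$H(z)=\frac{1}{\Gamma(z+1)}\prod_{p\in\mathcal{P}}\left(1-\frac{1}{q^{\deg(p)}}\right)^{z}\left(1-\frac{z}{q^{\deg(p)}}\right)^{-1}.$$
   Context: $\mathbb{F}_q$ is the finite field with $q$ elements; $q$ is fixed and implied constants may depend on $q$ (and here on $\epsilon$), but not on $n\geqslant 1$ or $z$. $\mathcal{M}_n$ is the set of monic polynomials of degree $n$ in $\mathbb{F}_q[t]$, $\mathcal{P}$ is the set of monic irreducible polynomials in $\mathbb{F}_q[t]$, and $\Omega(f)$ is the number of monic irreducible polynomials dividing $f$, counted with multiplicity. Complex powers of positive reals are principal: $a^z=e^{z\log a}$. The function $1/\Gamma$ is regarded as an entire function. *)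

(* Defs.v *)
From mathcomp Require Import all_boot all_order all_algebra all_field.
From mathcomp Require Import complex.
From mathcomp Require Import all_classical all_reals all_analysis.

Set Implicit Arguments.
Unset Strict Implicit.
Unset Printing Implicit Defensive.

Import Order.TTheory GRing.Theory Num.Theory.
Import numFieldNormedType.Exports.

Local Open Scope classical_set_scope.
Local Open Scope complex_scope.
Local Open Scope ring_scope.

Section ComplexAnalysis.
Variable R : realType.
Implicit Types (a : R) (z : R[i]).

(* R[i] carries no topology of its own; R[i]^o has the one given by the norm. *)
Definition clim (u : nat -> R[i]) : R[i] := lim ((u : nat -> R[i]^o) @ \oo).

Definition cexp z : R[i] :=
  let: x +i* y := z in (expR x)%:C * (cos y +i* sin y).

(* Principal power; only meaningful for a > 0. *)
Definition cpow a z : R[i] := cexp (z * (ln a)%:C).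

Definition euler_mascheroni : R :=
  lim ((fun n : nat => \sum_(1 <= k < n.+1) k%:R^-1 - ln (n%:R : R)) @ \oo).

(* The entire function 1 / Gamma, by its Weierstrass product
   z e^(gamma z) prod_(k >= 1) (1 + z / k) e^(- z / k). *)
Definition inv_Gamma z : R[i] :=
  z * cexp (euler_mascheroni%:C * z) *
  clim (fun n => \prod_(1 <= k < n.+1) ((1 + z / k%:R) * cexp (- (z / k%:R)))).

End ComplexAnalysis.

Section Polynomials.
Variable F : finFieldType.
Implicit Types p f : {poly F}.

Definition deg p : nat := (size p).-1.

Definition monic_deg (n : nat) f : bool := (f \is monic) && (size f == n.+1).

Definition monic_irred p : bool := (p \is monic) && irreducibleb p.

(* Exponent of p in f, for f != 0 and p not constant: then p ^+ k %| f forces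
   k <= deg f. *)
Definition mult p f : nat := \max_(k < size f | p ^+ k %| f) k.

(* A divisor of f != 0 has size at most size f, hence lies in {poly_(size f) F}. *)
Definition Omega f : nat :=
  \sum_(p : {poly_(size f) F} | monic_irred p) mult p f.

Variable R : realType.
Implicit Type z : R[i].

Definition M (n : nat) z : R[i] :=
  \sum_(f : {poly_n.+1 F} | monic_deg n f) z ^+ Omega f.

Definition euler_factor z p : R[i] :=
  cpow (1 - (#|F| ^ deg p)%:R^-1 : R) z * (1 - z / (#|F| ^ deg p)%:R)^-1.

(* The product over all monic irreducible polynomials, taken by increasing
   degree: {poly_N.+1 F} contains exactly those of degree at most N. *)
Definition H z : R[i] :=
  inv_Gamma (z + 1) *
  clim (fun N => \prod_(p : {poly_N.+1 F} | monic_irred p) euler_factor z p).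

End Polynomials.

(* Main.v *)
Require Import Defs.
From mathcomp Require Import all_boot all_order all_algebra all_field.
From mathcomp Require Import complex qpoly.
From mathcomp Require Import all_classical all_reals all_analysis.
From mathcomp Require Import zify ring lra.

(* Logarithmic differentiation of the Euler product of sum_f z^Omega(f) u^deg(f)
   gives n M_z(n) = sum_j c_j M_z(n - j), where c_j is the sum of deg(p) z^k over
   the prime powers p^k of degree j.  At z = 1 the same identity forces c_j = q^j,
   so that in general c_j = z q^j + O(q^j rho^j) for some rho < 1, only the powers
   with k >= 2 contributing to the error.  Hence M_z(n) / q^n is the convolution
   of the coefficients of (1 - u)^(-z) with a sequence g that decays
   geometrically.  The former are asymptotic to n^(z - 1) / Gamma(z) with relative
   error O(1 / n), by the Gauss product, and the sum of g is the Euler product at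
   u = 1 / q, because the exponential of sum_j b_j / j is the sum of the sequence
   with logarithmic derivative b.  All estimates are uniform in |z| <= q - eps, and
   everything is done on coefficients, without contour integration. *)

Set Implicit Arguments.
Unset Strict Implicit.
Unset Printing Implicit Defensive.

Import Order.TTheory GRing.Theory Num.Theory.
Import numFieldNormedType.Exports.
Import Normc.

Local Open Scope complex_scope.
Local Open Scope ring_scope.

(** The rate rho is dictated by two families of prime powers. For |z| <= A, the powers p^k with k >=
    2 and deg(p) = d contribute together at most 2 q^d A^k, to be compared with q^(kd). For d = 1
    the quotient is of order q (A/q)^k, for k = 2 of order A^2 q^(-d), so as functions of the total
    degree kd they decay like A/q and q^(-1/2). With A >= 1 both rates are at most (A/q)^(1/2). A
    second square root frees a factor that can be summed over d and k separately, whence A = rho^4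
    q.

    Complex logarithms never occur: the Euler factors are limits of exponentials of truncated
    logarithmic series, and only the real logarithm is used. Polynomial losses are accepted
    throughout, since part of a geometric decay always pays for them. *)

Local Notation Re := (@complex.Re _).
Local Notation Im := (@complex.Im _).

(** * Complex modulus, limits and exponential *)

Section Modulus.
Variable R : realType.
Implicit Types (x y : R) (z w : R[i]).

Lemma ReB z w : Re (z - w) = Re z - Re w.
Proof. by case: z w => ? ? []. Qed.

Lemma ImB z w : Im (z - w) = Im z - Im w.
Proof. by case: z w => ? ? []. Qed.

Lemma normr_normc z : `|z| = (normc z)%:C.
Proof. by case: z. Qed.

Lemma normc_ge0 z : 0 <= normc z.
Proof. by case: z => a b; rewrite sqrtr_ge0. Qed.

Lemma ler_normcD z w : normc (z + w) <= normc z + normc w.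
Proof. exact: (@le_normcD R). Qed.

Lemma normcNE z : normc (- z) = normc z.
Proof. exact: (@normcN R). Qed.

Lemma normcB z w : normc (z - w) = normc (w - z).
Proof. by rewrite -normcNE opprB. Qed.

Lemma ler_normcB z w : normc (z - w) <= normc z + normc w.
Proof. by rewrite -[normc w]normcNE; exact: ler_normcD. Qed.

Lemma ler_normc_dist u z w : normc (z - w) <= normc (z - u) + normc (u - w).
Proof. by have := ler_normcD (z - u) (u - w); rewrite addrA subrK. Qed.

Lemma normc_real x : normc x%:C = `|x|.
Proof. by rewrite /= expr0n addr0 sqrtr_sqr. Qed.

Lemma normc_nat n : normc (n%:R : R[i]) = n%:R.
Proof. by rewrite -(rmorph_nat (real_complex R)) normc_real normr_nat. Qed.

Lemma normcX z n : normc (z ^+ n) = normc z ^+ n.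
Proof. by elim: n => [|n IH]; rewrite ?expr0 ?normc1 // !exprS normcM IH. Qed.

Lemma normc_eq0 z : (normc z == 0) = (z == 0).
Proof. by apply/eqP/eqP => [/eq0_normc //|->]; rewrite normc0. Qed.

Lemma ler_normc_sum (I : Type) (s : seq I) (P : pred I) (f : I -> R[i]) :
  normc (\sum_(i <- s | P i) f i) <= \sum_(i <- s | P i) normc (f i).
Proof.
elim/big_rec2: _ => [|i x z _ le_zx]; first by rewrite normc0.
by apply: le_trans (ler_normcD _ _) _; rewrite lerD2l.
Qed.

Lemma normc_le_ReIm z : normc z <= `|Re z| + `|Im z|.
Proof.
case: z => a b /=; apply: (@le_trans _ _ (Num.sqrt ((`|a| + `|b|) ^+ 2))).
  rewrite ler_wsqrtr // sqrrD !real_normK ?num_real //.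
  by rewrite lerD2r lerDl mulrn_wge0 // mulr_ge0.
by rewrite sqrtr_sqr ger0_norm // addr_ge0.
Qed.

Lemma Re_le_normc z : `|Re z| <= normc z.
Proof. by case: z => a b /=; rewrite -sqrtr_sqr ler_wsqrtr // lerDl sqr_ge0. Qed.

Lemma Im_le_normc z : `|Im z| <= normc z.
Proof. by case: z => a b /=; rewrite -sqrtr_sqr ler_wsqrtr // lerDr sqr_ge0. Qed.

End Modulus.

Section ComplexLimits.
Variable R : realType.
Implicit Types (u : nat -> R[i]) (b : nat -> R) (l : R[i]).

(** Convergence is stated through the real sequence of moduli, so that the theory of real limits
    applies directly; [clim_tends] is the bridge to the limits in the definitions. *)
Definition tends u l := ((fun n => normc (u n - l)) @ \oo --> (0 : R))%classic.

Lemma clim_tends u l : tends u l -> clim u = l.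
Proof.
move=> ul; apply: (@cvg_lim R[i]^o); first exact: norm_hausdorff.
apply/(@cvgrPdist_lt R[i] R[i]^o) => e e0.
have e0' : 0 < Re e by move: e0; rewrite ltcE => /andP[].
have eE : e = (Re e)%:C by rewrite RRe_real // gtr0_real.
move/cvgrPdist_lt: ul => /(_ _ e0'); apply: filterS => n.
by rewrite sub0r normrN ger0_norm ?normc_ge0 // normr_normc eE ltcR normcB.
Qed.

Lemma tends_squeeze u l b : (b @ \oo --> (0 : R))%classic ->
  (forall n, normc (u n - l) <= b n) -> tends u l.
Proof.
move=> b0 ulb; apply: (squeeze_cvgr _ (cvg_cst 0) b0).
by apply: nearW => n; rewrite normc_ge0 ulb.
Qed.

Lemma cvg0_le (c : R) b : (b @ \oo --> (0 : R))%classic ->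
  (exists n0, forall n, (n0 <= n)%N -> c <= b n) -> c <= 0.
Proof.
move=> b0 [n0 cb]; apply: (cvgr_to_ge b0).
by exists n0 => // n /= /cb.
Qed.

(** Serves to pass an inequality to the limit: the distance to the limit may be added to the right
    side for free. *)
Lemma tends_le u l b (c : R) : tends u l -> (b @ \oo --> (0 : R))%classic ->
  (exists n0, forall n, (n0 <= n)%N -> c <= b n + normc (u n - l)) -> c <= 0.
Proof.
move=> ul b0 cb; apply: cvg0_le cb.
by have H := cvgD b0 ul; rewrite addr0 in H; exact: H.
Qed.

(** Completeness is applied to the real and the imaginary part, both additive and bounded by the
    modulus. Since the hypothesis bounds the distance to all later terms, the limit inherits the
    rate [b]. *)
Lemma cauchy_tends u b : (b @ \oo --> (0 : R))%classic ->
  (forall m n, (n <= m)%N -> normc (u m - u n) <= b n) ->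
  exists2 l, tends u l & forall n, normc (u n - l) <= b n.
Proof.
move=> b0 ub.
have cvg_part (f : R[i] -> R) : (forall z, `|f z| <= normc z) ->
    (forall z w, f (z - w) = f z - f w) -> cvgn (f \o u).
  move=> fle fB; apply/cauchy_cvgP/cauchy_exP => e e0.
  move/cvgrPdist_lt: b0 => /(_ _ e0) [n0 _ /(_ n0 (leqnn _)) /= bn0].
  exists (f (u n0)), n0 => // m /= n0m; rewrite /ball /= distrC -fB.
  apply: le_lt_trans (fle _) _; apply: le_lt_trans (ub _ _ n0m) _.
  by apply: le_lt_trans (ler_norm _) _; rewrite -normrN -sub0r.
have cRe := cvg_part Re (@Re_le_normc R) (@ReB R).
have cIm := cvg_part Im (@Im_le_normc R) (@ImB R).
pose l : R[i] := limn (Re \o u) +i* limn (Im \o u).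
have ul : tends u l.
  have cd (a : nat -> R) (c : R) : (a @ \oo --> c)%classic ->
      ((fun n => `|a n - c|) @ \oo --> (0 : R))%classic.
    move=> ac; rewrite -(normr0 R) -(subrr c).
    exact: (cvg_norm (cvgB ac (cvg_cst c))).
  apply: (@tends_squeeze _ _
    (fun n => `|(Re \o u) n - Re l| + `|(Im \o u) n - Im l|)); last first.
    by move=> n; apply: le_trans (normc_le_ReIm _) _; rewrite ReB ImB.
  have H := cvgD (cd _ _ cRe) (cd _ _ cIm).
  rewrite addr0 in H; exact: H.
exists l => // n; rewrite -subr_le0.
have := ul => /tends_le; apply; first exact: (cvg_cst (0 : R)).
exists n => m nm; rewrite add0r lerBlDl; apply: le_trans (ler_normc_dist (u m) _ _) _.
by rewrite lerD2r normcB ub.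
Qed.
End ComplexLimits.

Section ComplexExponential.
Variable R : realType.
Implicit Types (x y : R) (z w v : R[i]).

Lemma cexpD z w : cexp (z + w) = cexp z * cexp w.
Proof.
case: z w => [a b] [c d]; rewrite /cexp /= expRD cosD sinD.
by apply/eqP; rewrite eq_complex /=; apply/andP; split; apply/eqP; ring.
Qed.

Lemma cexp_real x : cexp x%:C = (expR x)%:C.
Proof.
rewrite /cexp /= cos0 sin0.
by apply/eqP; rewrite eq_complex /=; apply/andP; split; apply/eqP; ring.
Qed.

Lemma cexp0 : cexp 0 = 1 :> R[i].
Proof. by rewrite -[0]/((0 : R)%:C) cexp_real expR0. Qed.

Lemma cexpNK z : cexp (- z) * cexp z = 1.
Proof. by rewrite -cexpD addNr cexp0. Qed.

Lemma normc_cexp z : normc (cexp z) = expR (Re z).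
Proof.
case: z => a b; rewrite /cexp normcM normc_real ger0_norm ?expR_ge0 //.
by rewrite /normc cos2Dsin2 sqrtr1 mulr1.
Qed.

Lemma cexp_neq0 z : cexp z != 0.
Proof. by rewrite -normc_eq0 normc_cexp expR_eq0. Qed.

Lemma normc_cexp_le z : normc (cexp z) <= expR (normc z).
Proof.
by rewrite normc_cexp ler_expR; apply: le_trans (ler_norm _) (Re_le_normc z).
Qed.

Lemma cexp_sum (I : Type) (s : seq I) (P : pred I) (f : I -> R[i]) :
  cexp (\sum_(i <- s | P i) f i) = \prod_(i <- s | P i) cexp (f i).
Proof. exact: (big_morph _ cexpD cexp0). Qed.

Lemma ler_norm_sin x : `|sin x| <= `|x|.
Proof.
wlog x0 : x / 0 <= x => [H|].
  have [/H //|/ltW x0] := leP 0 x.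
  by rewrite -normrN -sinN -[in leRHS]normrN; apply: H; rewrite oppr_ge0.
have [c _] := @MVT_segment R sin cos 0 x x0 (fun y _ => is_derive_sin y)
  (continuous_subspaceT (@continuous_sin R)).
rewrite sin0 !subr0 => ->; rewrite normrM ler_piMl //.
exact: cos_max.
Qed.

Lemma ler_norm_cosB1 x : `|cos x - 1| <= x ^+ 2 / 2.
Proof.
have -> : cos x - 1 = - (sin (x / 2) ^+ 2 *+ 2).
  by rewrite {1}(splitr x) -mulr2n cos_mulr2n sin2cos2; ring.
rewrite normrN normrMn normrX.
have : `|sin (x / 2)| ^+ 2 <= `|x / 2| ^+ 2 by rewrite lerXn2r ?nnegrE // ler_norm_sin.
rewrite normrM exprMn !real_normK ?num_real // -mulr_natr.
have := sqr_ge0 x; lra.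
Qed.

Lemma ler_norm_sinB x : `|sin x - x| <= x ^+ 2.
Proof.
wlog x0 : x / 0 <= x => [H|].
  have [/H //|/ltW x0] := leP 0 x.
  have := H (- x); rewrite sinN opprK sqrrN -normrN opprD !opprK.
  by apply; rewrite oppr_ge0.
have D y : y \in `]0, x[ -> is_derive y 1 (sin - id : R -> R) (cos y - 1).
  by move=> _; apply: is_deriveB.
have [|c c01] := @MVT_segment R (sin - id : R -> R) (fun y => cos y - 1) 0 x x0 D.
  apply: continuous_subspaceT => y; apply: cvgB; first exact: continuous_sin.
  exact: cvg_id.
rewrite !fctE sin0 !subr0 => ->.
rewrite normrM (ger0_norm x0) expr2 ler_wpM2r //.
move: c01; rewrite in_itv /= => /andP[c0 cx]; apply: le_trans cx.
(* Below 2 the bound c^2 / 2 is at most c; from 2 on, the trivial bound 2 is. *)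
have [c2|/ltW c2] := leP c 2.
  apply: le_trans (ler_norm_cosB1 c) _; rewrite expr2; nra.
rewrite ler_norml; have := cos_geN1 c; have := cos_le1 c; lra.
Qed.

End ComplexExponential.

Section ExponentialTaylor.
Variable R : realType.
Implicit Types (x y : R) (z w v : R[i]).
Lemma expRB1_le x : expR x - 1 <= x * expR x.
Proof.
have := expR_ge1Dx (- x); rewrite expRN => H.
have := expR_gt0 x => e0.
have : (1 - x) * expR x <= 1 by rewrite -ler_pdivlMr // mul1r.
by lra.
Qed.

Lemma ler_norm_expRB1 x : `|expR x - 1| <= `|x| * expR `|x|.
Proof.
have [x0|x0] := leP 0 x.
  rewrite (ger0_norm x0) ger0_norm ?expRB1_le // subr_ge0.
  by have := expR_ge1Dx x; lra.
have : 1 <= expR `|x| by rewrite -expR0 ler_expR.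
have := expR_ge1Dx x.
rewrite (ltr0_norm x0) ltr0_norm ?subr_lt0 ?expR_lt1 // => H1 H2.
nra.
Qed.

Lemma ler_norm_expRB1B x : `|expR x - 1 - x| <= x ^+ 2 * expR `|x|.
Proof.
have H1 := expR_ge1Dx x; have H2 := expRB1_le x.
have H3 : 1 <= expR `|x| by rewrite -expR0 ler_expR.
rewrite ger0_norm; last by lra.
apply: (@le_trans _ _ (x * (expR x - 1))); first lra.
rewrite -real_normK ?num_real // expr2 -mulrA.
apply: le_trans (ler_norm _) _; rewrite normrM ler_wpM2l //.
exact: ler_norm_expRB1.
Qed.

(** The real and imaginary parts split into four real remainders, each at most |v|^2 e^|v|; hence
    the 4. *)
Lemma cexp_taylor2 v : normc (cexp v - 1 - v) <= 4 * normc v ^+ 2 * expR (normc v).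
Proof.
case: v => a b; set n := normc (a +i* b).
have Ha : `|a| <= n := Re_le_normc (a +i* b).
have Hb : `|b| <= n := Im_le_normc (a +i* b).
have n0 : 0 <= n := normc_ge0 _.
have En : expR `|a| <= expR n by rewrite ler_expR.
have En1 : 1 <= expR n by rewrite -expR0 ler_expR.
have Ea : expR a <= expR n by rewrite ler_expR; apply: le_trans (ler_norm _) Ha.
have a2 : a ^+ 2 <= n ^+ 2 by rewrite -real_normK ?num_real // lerXn2r.
have b2 : b ^+ 2 <= n ^+ 2 by rewrite -real_normK ?num_real // lerXn2r.
apply: le_trans (normc_le_ReIm _) _.
have -> : Re (cexp (a +i* b) - 1 - (a +i* b)) =
    (expR a - 1 - a) + expR a * (cos b - 1) by rewrite /cexp /=; ring.
have -> : Im (cexp (a +i* b) - 1 - (a +i* b)) =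
    expR a * (sin b - b) + (expR a - 1) * b by rewrite /cexp /=; ring.
have T1 : `|expR a - 1 - a| <= n ^+ 2 * expR n.
  apply: le_trans (ler_norm_expRB1B a) _.
  by apply: ler_pM; rewrite ?sqr_ge0 ?expR_ge0.
have T2 : `|expR a * (cos b - 1)| <= n ^+ 2 * expR n.
  rewrite normrM (ger0_norm (expR_ge0 a)) mulrC.
  apply: ler_pM; rewrite ?expR_ge0 ?normr_ge0 //.
  by apply: le_trans (ler_norm_cosB1 b) _; have := sqr_ge0 b; lra.
have T3 : `|expR a * (sin b - b)| <= n ^+ 2 * expR n.
  rewrite normrM (ger0_norm (expR_ge0 a)) mulrC.
  apply: ler_pM; rewrite ?expR_ge0 ?normr_ge0 //.
  exact: le_trans (ler_norm_sinB b) _.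
have T4 : `|(expR a - 1) * b| <= n ^+ 2 * expR n.
  rewrite normrM expr2 mulrAC; apply: ler_pM; rewrite ?normr_ge0 //.
  apply: le_trans (ler_norm_expRB1 a) _.
  by apply: ler_pM; rewrite ?expR_ge0 ?normr_ge0.
have := ler_normD (expR a - 1 - a) (expR a * (cos b - 1)).
have := ler_normD (expR a * (sin b - b)) ((expR a - 1) * b).
lra.
Qed.

(** The form x e^x with x = 5 |v| requires no smallness of v and still vanishes with v. The
    quadratic term of [cexp_taylor2] is absorbed by 1 + 4 |v| <= e^(4 |v|). *)
Lemma cexp_taylor1 v : normc (cexp v - 1) <= 5 * normc v * expR (5 * normc v).
Proof.
set n := normc v; have n0 : 0 <= n := normc_ge0 _.
have H : normc (cexp v - 1) <= 4 * n ^+ 2 * expR n + n.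
  rewrite -[cexp v - 1](subrK v); apply: le_trans (ler_normcD _ _) _.
  by rewrite lerD2r cexp_taylor2.
apply: le_trans H _.
have E4 : 1 + 4 * n <= expR (4 * n) := expR_ge1Dx _.
have E1 : 1 <= expR n by rewrite -expR0 ler_expR.
have -> : expR (5 * n) = expR (4 * n) * expR n.
  by rewrite -expRD; congr expR; ring.
have : (1 + 4 * n) * expR n <= expR (4 * n) * expR n.
  by rewrite ler_wpM2r // expR_ge0.
have : 0 <= expR n by rewrite expR_ge0.
nra.
Qed.
End ExponentialTaylor.

(** * Convolutions and logarithmic derivatives *)

Section Convolution.
Variable K : comNzRingType.
Implicit Types f g h b c : nat -> K.

Definition conv f g n : K := \sum_(i < n.+1) f i * g (n - i)%N.

(** Lets [conv] inherit commutativity and associativity from [{poly K}]: truncation at N does not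
    affect the coefficients below N. *)
Lemma conv_coefM N f g n : (n < N)%N ->
  conv f g n = (\poly_(i < N) f i * \poly_(i < N) g i)`_n.
Proof.
move=> nN; rewrite coefM; apply: eq_bigr => i _; rewrite !coef_poly.
by rewrite (leq_ltn_trans (leq_subr _ _) nN) (leq_ltn_trans _ nN) // -ltnS.
Qed.

Lemma eq_conv f f' g g' n : (forall i, (i <= n)%N -> f i = f' i) ->
  (forall i, (i <= n)%N -> g i = g' i) -> conv f g n = conv f' g' n.
Proof.
by move=> ff' gg'; apply: eq_bigr => i _; rewrite ff' ?gg' ?leq_subr // -ltnS.
Qed.

Lemma convC f g n : conv f g n = conv g f n.
Proof. by rewrite !(@conv_coefM n.+1) // mulrC. Qed.

Lemma convA f g h n : conv f (conv g h) n = conv (conv f g) h n.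
Proof.
pose P f := \poly_(i < n.+1) f i.
have PM f1 g1 (p : {poly K}) : (P (conv f1 g1) * p)`_n = (P f1 * P g1 * p)`_n.
  rewrite !coefM; apply: eq_bigr => i _; congr (_ * _).
  by rewrite coef_poly ltn_ord (@conv_coefM n.+1).
rewrite !(@conv_coefM n.+1) // -!/(P _) PM [_ * P (conv _ _)]mulrC PM.
by rewrite [P g * P h * _]mulrC mulrA.
Qed.

Lemma convDl f g h n : conv (fun i => f i + g i) h n = conv f h n + conv g h n.
Proof. by rewrite -big_split; apply: eq_bigr => i _; rewrite mulrDl. Qed.

Lemma conv1l f n : conv (fun i => (i == 0%N)%:R) f n = f n.
Proof.
rewrite /conv big_ord_recl /= mul1r subn0 big1 ?addr0 // => i _.
by rewrite mul0r.
Qed.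

(* For the generating functions G of g and B of b, this says u G'(u) = B(u) G(u). *)
Definition logderiv b g := forall n, n%:R * g n = conv b g n.

Lemma eq_logderiv b b' g g' : b =1 b' -> g =1 g' -> logderiv b g -> logderiv b' g'.
Proof.
by move=> bb' gg' H n; rewrite -gg' H; apply: eq_conv => i _.
Qed.

(** The logarithmic derivative of a product is the sum of those of the factors; the Leibniz rule is
    n = i + (n - i) inside the convolution. *)
Lemma logderiv_conv b c g h : logderiv b g -> logderiv c h ->
  logderiv (fun i => b i + c i) (conv g h).
Proof.
move=> bg ch n; rewrite convDl convA.
have -> : conv (conv b g) h n = conv (fun i => i%:R * g i) h n.
  by apply: eq_conv => i _ //; rewrite bg.
have -> : conv c (conv g h) n = conv g (fun i => i%:R * h i) n.
  rewrite convC -convA; apply: eq_conv => i _ //; rewrite ch; exact: convC.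
rewrite /conv mulr_sumr -big_split; apply: eq_bigr => i _ /=.
have -> : n%:R = (i%:R + (n - i)%:R :> K) by rewrite -natrD subnKC // -ltnS.
by move: (n - i)%N => k; ring.
Qed.

Lemma logderiv_scale x b g : logderiv b g ->
  logderiv (fun i => b i * x ^+ i) (fun i => g i * x ^+ i).
Proof.
move=> bg n; rewrite mulrA bg mulr_suml; apply: eq_bigr => i _.
have -> : x ^+ n = x ^+ i * x ^+ (n - i) by rewrite -exprD subnKC // -ltnS.
ring.
Qed.

(** Coefficients of z u / (1 - u), which is u times the logarithmic derivative of (1 - u)^(- z). *)
Definition posc (z : K) n := (0 < n)%:R * z.

Lemma logderiv_geometric w : logderiv (fun i => posc 1 i * w ^+ i) (fun i => w ^+ i).
Proof.
move=> n; rewrite /conv big_ord_recl /posc /= !mul0r add0r.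
rewrite (eq_bigr (fun=> w ^+ n)) => [|i _].
  by rewrite sumr_const card_ord mulr_natl.
by rewrite !mul1r -exprD subnKC.
Qed.

End Convolution.

Section Recurrence.
Variable K : numFieldType.
Implicit Types (f g h b c : nat -> K) (z w : K).

(** At index 0 the identity forces b 0 = 0, so that n g(n) involves only earlier values of g. *)
Lemma logderiv_uniq b g h : logderiv b g -> logderiv b h ->
  g 0%N = 1 -> h 0%N = 1 -> g =1 h.
Proof.
move=> bg bh g0 h0; have b0 : b 0%N = 0.
  by have := bg 0%N; rewrite /conv big_ord1 mul0r subnn g0 mulr1 => /esym.
elim/ltn_ind => -[_|n IH]; first by rewrite g0 h0.
apply: (@mulfI _ n.+1%:R); first by rewrite pnatr_eq0.
rewrite bg bh /conv [LHS]big_ord_recl [RHS]big_ord_recl b0 !mul0r !add0r.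
apply: eq_bigr => i _.
by rewrite IH // lift0 subSS ltnS leq_subr.
Qed.

(** The rising factorial z (z + 1) ... (z + m - 1) divided by m!. *)
Definition rising z m : K := \prod_(k < m) ((k%:R + z) / k.+1%:R).

Lemma risingS z m : rising z m.+1 = rising z m * ((m%:R + z) / m.+1%:R).
Proof. by rewrite /rising big_ord_recr. Qed.

Lemma rising0 z : rising z 0 = 1.
Proof. by rewrite /rising big_ord0. Qed.

Lemma sum_rising z n : \sum_(i < n) z * rising z i = n%:R * rising z n.
Proof.
elim: n => [|n IH]; first by rewrite big_ord0 mul0r.
rewrite big_ord_recr /= IH risingS mulrCA [n.+1%:R * _]mulrC.
by rewrite divfK ?pnatr_eq0 //; ring.
Qed.

(* The generating function of [rising z] is (1 - u)^(- z). *)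
Lemma logderiv_rising z : logderiv (posc z) (rising z).
Proof.
move=> n; rewrite -sum_rising /conv big_ord_recl /posc /= !mul0r add0r.
rewrite (reindex_inj rev_ord_inj) /=; apply: eq_bigr => i _.
by rewrite mul1r.
Qed.

(** (1 - u)^(- z) (1 - u)^z = 1: both sides have logarithmic derivative 0 and constant term 1. *)
Lemma conv_rising_opp z n : conv (rising z) (rising (- z)) n = (n == 0%N)%:R.
Proof.
move: n; apply: (@logderiv_uniq (fun=> 0)) => // [||].
- apply: (eq_logderiv _ (frefl _)
    (logderiv_conv (logderiv_rising z) (logderiv_rising (- z)))) => i.
  by rewrite /posc mulrN addrN.
- by move=> -[|n]; rewrite /conv big1 ?mul0r ?mulr0 // => i _; rewrite mul0r.
- by rewrite /conv big_ord1 !rising0 mulr1.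
Qed.

End Recurrence.

Section RealBounds.
Variable R : rcfType.
Implicit Types x y : R.

Lemma bernoulli x n : 0 <= x -> 1 + n%:R * x <= (1 + x) ^+ n.
Proof.
move=> x0; elim: n => [|n IH]; first by rewrite mul0r addr0 expr0.
rewrite exprSr; apply: (@le_trans _ _ ((1 + n%:R * x) * (1 + x))).
  rewrite -natr1; have : 0 <= n%:R * x * x by rewrite !mulr_ge0.
  lra.
by rewrite ler_wpM2r // addr_ge0.
Qed.

Lemma rising_ge0 x m : 0 <= x -> 0 <= rising x m.
Proof. by move=> x0; apply: prodr_ge0 => i _; rewrite divr_ge0 // addr_ge0. Qed.

(** Each factor (m + B) / (m + 1) is at most 1 + B / (m + 1), hence by Bernoulli at most ((m + 2) /
    (m + 1))^B, and these telescope. *)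
Lemma rising_nat_le (B : nat) m : rising B%:R m <= m.+1%:R ^+ B :> R.
Proof.
elim: m => [|m IH]; first by rewrite rising0 expr1n.
have p0 : 0 < m.+1%:R :> R by rewrite ltr0n.
have -> : m.+2%:R = m.+1%:R * (1 + m.+1%:R^-1) :> R.
  by rewrite mulrDr mulr1 mulfV ?gt_eqF // natr1.
rewrite risingS exprMn.
apply: ler_pM; rewrite ?rising_ge0 ?divr_ge0 ?addr_ge0 //.
apply: le_trans (bernoulli _ _); last by rewrite invr_ge0.
rewrite mulrDl lerD2r ler_pdivrMr // mul1r ler_nat.
exact: leqnSn.
Qed.

Lemma sum_geometric_le x n : 0 <= x -> x < 1 -> \sum_(i < n) x ^+ i <= (1 - x)^-1.
Proof.
move=> x0 x1; have p : 0 < 1 - x by rewrite subr_gt0.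
rewrite -[leRHS]mul1r ler_pdivlMr // mulrC -opprB mulNr -subrX1 opprB.
by rewrite lerBlDr lerDl exprn_ge0.
Qed.

Lemma succ_geometric_le x k : 0 <= x -> x < 1 -> k.+1%:R * x ^+ k <= (1 - x)^-1.
Proof.
move=> x0 x1; apply: le_trans (sum_geometric_le k.+1 x0 x1).
rewrite mulr_natl -[in leLHS](card_ord k.+1) -sumr_const; apply: ler_sum => i _.
by rewrite ler_wiXn2l // ?ltW // -ltnS.
Qed.

Lemma sqrt_lt1 x : 0 <= x -> x < 1 -> Num.sqrt x < 1.
Proof. by move=> x0 x1; rewrite -sqrtr1 ltr_sqrt. Qed.

(** With x = y^2, one copy of y^k pays for one factor k + 1 and the other is left for the
    induction. *)
Lemma poly_geometric_le (B : nat) x : 0 <= x -> x < 1 ->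
  exists2 C, 0 < C & forall k, k.+1%:R ^+ B * x ^+ k <= C.
Proof.
elim: B x => [|B IH] x x0 x1.
  by exists 1 => // k; rewrite expr0 mul1r exprn_ile1 // ltW.
have y0 := sqrtr_ge0 x; have y1 := sqrt_lt1 x0 x1; set y := Num.sqrt x in y0 y1.
have [C C0 HC] := IH y y0 y1; have p : 0 < (1 - y)^-1 by rewrite invr_gt0 subr_gt0.
exists ((1 - y)^-1 * C) => [|k]; first by rewrite mulr_gt0.
have -> : x ^+ k = y ^+ k * y ^+ k by rewrite -exprMn -expr2 sqr_sqrtr.
rewrite exprS mulrACA; apply: ler_pM; rewrite ?mulr_ge0 ?exprn_ge0 //.
exact: succ_geometric_le.
Qed.

End RealBounds.

(** * The exponential formula *)

Section QuadraticRemainder.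
Variable R : realType.
Implicit Types (f g : R -> R[i]) (s t K : R).

(* Differentiability on [0, 1] with a uniform quadratic remainder: it is stable under
   the operations needed and yields a mean value inequality for complex values. *)
Definition qdiff f f' := exists2 K, 0 <= K & forall s t, 0 <= s <= 1 -> 0 <= t <= 1 ->
  [/\ normc (f t) <= K, normc (f' t) <= K &
      normc (f s - f t - (s - t)%:C * f' t) <= K * (s - t) ^+ 2].

Lemma qdiff_const (c : R[i]) : qdiff (fun=> c) (fun=> 0).
Proof.
exists (normc c); first exact: normc_ge0.
move=> s t _ _; rewrite mulr0 subrr subr0 normc0.
by rewrite mulr_ge0 ?sqr_ge0 ?normc_ge0.
Qed.

Lemma qdiff_id : qdiff (fun t => t%:C) (fun=> 1).
Proof.
exists 1 => // s t _ /andP[t0 t1]; rewrite mulr1 -rmorphB subrr normc0 normc1.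
by rewrite normc_real ger0_norm // mulr_ge0 ?sqr_ge0.
Qed.

Lemma qdiffD f f' g g' : qdiff f f' -> qdiff g g' ->
  qdiff (fun t => f t + g t) (fun t => f' t + g' t).
Proof.
move=> [K K0 Hf] [L L0 Hg]; exists (K + L); first exact: addr_ge0.
move=> s t s01 t01; have [f1 f2 f3] := Hf s t s01 t01; have [g1 g2 g3] := Hg s t s01 t01.
split; [exact: le_trans (ler_normcD _ _) (lerD f1 g1)|
        exact: le_trans (ler_normcD _ _) (lerD f2 g2)|].
rewrite mulrDl; apply: le_trans (lerD f3 g3); apply: le_trans (ler_normcD _ _).
by rewrite (_ : _ - _ = f s - f t - (s - t)%:C * f' t + (g s - g t - (s - t)%:C * g'
  t)) //; ring.
Qed.

Lemma qdiff_lip f f' K s t : 0 <= K -> 0 <= s <= 1 -> 0 <= t <= 1 ->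
  normc (f' t) <= K ->
  normc (f s - f t - (s - t)%:C * f' t) <= K * (s - t) ^+ 2 ->
  normc (f s - f t) <= 2 * K * `|s - t|.
Proof.
move=> K0 /andP[s0 s1] /andP[t0 t1] f2 f3.
rewrite -(subrK ((s - t)%:C * f' t) (f s - f t)).
apply: le_trans (ler_normcD _ _) _; apply: le_trans (lerD f3 (lexx _)) _.
rewrite normcM normc_real.
have st : `|s - t| <= 1 by rewrite ler_norml; apply/andP; split; lra.
have : `|s - t| * normc (f' t) <= `|s - t| * K by rewrite ler_wpM2l.
rewrite -real_normK ?num_real //; have := normr_ge0 (s - t).
move: `|s - t| st => h h1 h0 H.
have : K * h ^+ 2 <= K * h by rewrite ler_wpM2l // expr2 ler_piMl.
lra.
Qed.

Lemma qdiffM f f' g g' : qdiff f f' -> qdiff g g' ->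
  qdiff (fun t => f t * g t) (fun t => f' t * g t + f t * g' t).
Proof.
move=> [K K0 Hf] [L L0 Hg]; exists (4 * (K * L)); first by rewrite !mulr_ge0.
move=> s t s01 t01; have [f1 f2 f3] := Hf s t s01 t01; have [g1 g2 g3] := Hg s t s01 t01.
have [gs _ _] := Hg s s s01 s01.
have glip := qdiff_lip L0 s01 t01 g2 g3.
have KL : 0 <= K * L by rewrite mulr_ge0.
split.
- rewrite normcM; apply: (@le_trans _ _ (K * L)); last lra.
  by apply: ler_pM; rewrite ?normc_ge0.
- apply: le_trans (ler_normcD _ _) _; rewrite !normcM.
  apply: (@le_trans _ _ (K * L + K * L)); last lra.
  by apply: lerD; apply: ler_pM; rewrite ?normc_ge0.
(* The remainder of f times g s, a cross term that is quadratic by the Lipschitz bound on g, and f t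
   times the remainder of g: they cost K L, 2 K L and K L. *)
rewrite (_ : _ - _ = (f s - f t - (s - t)%:C * f' t) * g s
   + ((s - t)%:C * f' t * (g s - g t) + f t * (g s - g t - (s - t)%:C * g' t)));
     last by ring.
rewrite -(real_normK (num_real (s - t))) in f3 g3 *.
have [h0 hE] : 0 <= `|s - t| /\ normc (s - t)%:C = `|s - t| by rewrite normc_real.
move: `|s - t| h0 hE f3 g3 glip => h h0 hE f3 g3 glip.
do 2 (apply: le_trans (ler_normcD _ _) _; rewrite -?lerBrDl); rewrite ?lerBrDl.
rewrite !normcM hE.
have A1 : normc (f s - f t - (s - t)%:C * f' t) * normc (g s) <= K * h ^+ 2 * L.
  by apply: ler_pM; rewrite ?normc_ge0.
have A2 : h * normc (f' t) * normc (g s - g t) <= h * K * (2 * L * h).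
  by apply: ler_pM; rewrite ?mulr_ge0 ?normc_ge0 //; apply: ler_wpM2l.
have A3 : normc (f t) * normc (g s - g t - (s - t)%:C * g' t) <= K * (L * h ^+ 2).
  by apply: ler_pM; rewrite ?normc_ge0.
have -> : 4 * (K * L) * h ^+ 2 = K * h ^+ 2 * L + (h * K * (2 * L * h) + K * (L * h ^+ 2)).
  by ring.
lra.
Qed.

Lemma qdiff_horner (p : {poly R[i]}) : qdiff (fun t => p.[t%:C]) (fun t => p^`().[t%:C]).
Proof.
elim/poly_ind: p => [|p c IH].
  have := qdiff_const 0; case=> K K0 H; exists K => // s t s01 t01.
  by have := H s t s01 t01; rewrite deriv0 !horner0.
have [K K0 H] := qdiffD (qdiffM IH qdiff_id) (qdiff_const c).
exists K => // s t s01 t01; have := H s t s01 t01.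
rewrite !hornerMXaddC derivMXaddC hornerD hornerMX.
by rewrite mulr1 addr0 [p.[_] + _ * _]addrC.
Qed.

Lemma qdiff_cexp f f' : qdiff f f' ->
  qdiff (fun t => cexp (f t)) (fun t => f' t * cexp (f t)).
Proof.
(* The first summand bounds the Taylor remainder of [cexp] at v = f s - f t, as |v| <= 2 K |s - t|;
   K bounds the remainder of f, and the 1 makes L at least the bound e^K on [cexp (f t)]. *)
move=> [K K0 Hf]; pose L := expR K * (16 * K ^+ 2 * expR (2 * K) + K + 1).
have e0 : 0 <= expR (2 * K) by rewrite expR_ge0.
have T0 : 0 <= 16 * K ^+ 2 * expR (2 * K) by rewrite !mulr_ge0 ?sqr_ge0.
have E0 : 0 <= expR K by rewrite expR_ge0.
exists L; first by rewrite mulr_ge0 // !addr_ge0.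
move=> s t s01 t01; have [f1 f2 f3] := Hf s t s01 t01.
have et : normc (cexp (f t)) <= expR K.
  by apply: le_trans (normc_cexp_le _) _; rewrite ler_expR.
split.
- by apply: le_trans et _; rewrite ler_peMr // lerDr addr_ge0.
- rewrite normcM mulrC /L; apply: ler_pM; rewrite ?normc_ge0 //; lra.
have lip := qdiff_lip K0 s01 t01 f2 f3.
set v := f s - f t in lip f3.
have -> : cexp (f s) = cexp (f t) * cexp v by rewrite -cexpD addrC subrK.
rewrite (_ : _ - _ = cexp (f t) * ((cexp v - 1 - v) + (v - (s - t)%:C * f' t)));
  last by ring.
rewrite normcM -mulrA; apply: ler_pM; rewrite ?normc_ge0 //.
apply: le_trans (ler_normcD _ _) _.
move: (cexp_taylor2 v) => H1.
have h1 : `|s - t| <= 1.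
  by move: s01 t01 => /andP[? ?] /andP[? ?]; rewrite ler_norml; apply/andP; split; lra.
have nv := normc_ge0 v.
have v2 : normc v ^+ 2 <= 4 * K ^+ 2 * (s - t) ^+ 2.
  rewrite -(real_normK (num_real (s - t))).
  have -> : 4 * K ^+ 2 * `|s - t| ^+ 2 = (2 * K * `|s - t|) ^+ 2 by ring.
  by rewrite lerXn2r // nnegrE !mulr_ge0.
have ev : expR (normc v) <= expR (2 * K).
  rewrite ler_expR; apply: le_trans lip _; rewrite ler_piMr // mulr_ge0 //.
have H2 : normc v ^+ 2 * expR (normc v) <= 4 * K ^+ 2 * (s - t) ^+ 2 * expR (2 * K).
  by apply: ler_pM; rewrite ?sqr_ge0 ?expR_ge0.
have := sqr_ge0 (s - t); lra.
Qed.

(** No intermediate point exists for complex values. Instead [0, 1] is cut into n + 1 equal pieces: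
    each contributes at most e / (n + 1) plus a remainder K / (n + 1)^2, and the remainders add up
    to K / (n + 1), which tends to 0. *)
Lemma qdiff_mean_value f f' (e : R) : qdiff f f' ->
  (forall t, 0 <= t <= 1 -> normc (f' t) <= e) -> normc (f 1 - f 0) <= e.
Proof.
move=> [K K0 Hf] Hf'; rewrite -subr_le0.
have KH : ((fun n => K * harmonic n) @ \oo --> (0 : R))%classic.
  rewrite -(mulr0 K); exact: (cvgM (cvg_cst K) (@cvg_harmonic R)).
apply: (cvg0_le KH); exists 0%N => n _ /=.
have n0 : 0 < n.+1%:R :> R by rewrite ltr0n.
rewrite lerBlDr.
have -> : f 1 - f 0 = \sum_(i < n.+1) (f (i.+1%:R / n.+1%:R) - f (i%:R / n.+1%:R)).
  rewrite -(big_mkord xpredT (fun i => f (i.+1%:R / n.+1%:R) - f (i%:R / n.+1%:R))).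
  by rewrite telescope_sumr // mulfV ?gt_eqF // mul0r.
apply: le_trans (ler_normc_sum _ _ _) _.
apply: (@le_trans _ _ (\sum_(i < n.+1) (K * (n.+1%:R^-1) ^+ 2 + e * n.+1%:R^-1))).
  apply: ler_sum => i _.
  have i1 : 0 <= (i.+1%:R / n.+1%:R : R) <= 1.
    by rewrite divr_ge0 //= ler_pdivrMr // mul1r ler_nat.
  have i0 : 0 <= (i%:R / n.+1%:R : R) <= 1.
    by rewrite divr_ge0 //= ler_pdivrMr // mul1r ler_nat ltnW.
  have [_ _] := Hf _ _ i1 i0.
  have -> : i.+1%:R / n.+1%:R - i%:R / n.+1%:R = n.+1%:R^-1 :> R.
    by rewrite -mulrBl -natr1 addrC addKr mul1r.
  move=> H; rewrite -(subrK (n.+1%:R^-1%:C * f' (i%:R / n.+1%:R)) (f _ - f _)).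
  apply: le_trans (ler_normcD _ _) _; apply: lerD => //.
  rewrite normcM normc_real ger0_norm ?invr_ge0 // mulrC ler_wpM2r ?invr_ge0 //.
  exact: Hf'.
rewrite sumr_const card_ord -[leLHS]mulr_natl mulrDr lerD //.
  by rewrite expr2 mulrCA (mulrA n.+1%:R) mulfV ?gt_eqF // mul1r.
by rewrite mulrCA mulfV ?gt_eqF // mulr1.
Qed.

End QuadraticRemainder.

Section PolyGeometric.
Variable R : realType.
Implicit Types x : R.

Lemma cvg_geometric0 (C x : R) : 0 <= x -> x < 1 ->
  ((fun n => C * x ^+ n) @ \oo --> (0 : R))%classic.
Proof. by move=> x0 x1; apply: (@cvg_geometric R C x); rewrite ger0_norm. Qed.

Lemma poly_geometric_decay (B : nat) x : 0 <= x -> x < 1 ->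
  exists C y, [/\ 0 < C, 0 <= y, y < 1 & forall k, k.+1%:R ^+ B * x ^+ k <= C * y ^+ k].
Proof.
move=> x0 x1; have y0 := sqrtr_ge0 x; have y1 := sqrt_lt1 x0 x1.
set y := Num.sqrt x in y0 y1.
have [C C0 HC] := poly_geometric_le B y0 y1.
exists C, y; split=> // k.
have -> : x ^+ k = y ^+ k * y ^+ k by rewrite -exprMn -expr2 sqr_sqrtr.
by rewrite mulrA ler_wpM2r ?exprn_ge0.
Qed.

End PolyGeometric.

Section LogDerivativeBounds.
Variable R : realType.
Implicit Types (b g : nat -> R[i]) (c h : nat -> R).

Lemma logderiv0 b g : logderiv b g -> g 0%N = 1 -> b 0%N = 0.
Proof.
by move=> bg g0; have := bg 0%N; rewrite /conv big_ord1 mul0r subnn g0 mulr1 => /esym.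
Qed.

(** Majorant principle: the recursion combines b and earlier values of g by sums and products only,
    so termwise bounds propagate. *)
Lemma logderiv_le b g c h : logderiv b g -> logderiv c h -> g 0%N = 1 -> h 0%N = 1 ->
  (forall j, normc (b j) <= c j) -> forall n, normc (g n) <= h n.
Proof.
move=> bg ch g0 h0 bc; have b0 := logderiv0 bg g0.
have c0 : c 0%N = 0.
  by have := ch 0%N; rewrite /conv big_ord1 mul0r subnn h0 mulr1 => /esym.
elim/ltn_ind => -[_|n IH]; first by rewrite g0 h0 normc1.
rewrite -(ler_pM2l (ltr0Sn R n)) -normc_nat -normcM bg normc_nat ch.
apply: le_trans (ler_normc_sum _ _ _) _.
rewrite [leLHS]big_ord_recl [leRHS]big_ord_recl b0 c0 !mul0r normc0 !add0r.
apply: ler_sum => i _; rewrite normcM; apply: ler_pM; rewrite ?normc_ge0 //.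
by rewrite IH // lift0 subSS ltnS leq_subr.
Qed.

(** The majorant is (1 - x u)^(- B). Taking B an integer keeps its coefficients below a natural
    power of n + 1. *)
Lemma logderiv_geometric_le b g (B : nat) (x : R) : 0 <= x ->
  logderiv b g -> g 0%N = 1 -> (forall j, normc (b j) <= B%:R * x ^+ j) ->
  forall n, normc (g n) <= n.+1%:R ^+ B * x ^+ n.
Proof.
move=> x0 bg g0 bB n; have b0 := logderiv0 bg g0.
apply: (@le_trans _ _ (rising B%:R n * x ^+ n)); last first.
  by rewrite ler_wpM2r ?exprn_ge0 // rising_nat_le.
move: n; apply: (logderiv_le bg (logderiv_scale x (logderiv_rising B%:R))) => //.
  by rewrite rising0 expr0 mulr1.
by move=> -[|j]; rewrite /posc ?b0 ?normc0 ?mul0r // mul1r bB.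
Qed.

End LogDerivativeBounds.

Section ExponentialFormula.
Variable R : realType.
Variables (b g : nat -> R[i]) (B : nat) (x : R).
Hypotheses (x0 : 0 <= x) (x1 : x < 1) (bg : logderiv b g) (g0 : g 0%N = 1).
Hypothesis bB : forall j, normc (b j) <= B%:R * x ^+ j.

Let b0 : b 0%N = 0 := logderiv0 bg g0.
Let gB := logderiv_geometric_le x0 bg g0 bB.

(** Truncations of the generating function of g and of its logarithm. The constant coefficient of
    [S] reads b 0 / 0, which is 0. *)
Let phi N := \poly_(i < N.+1) g i.
Let S N := \poly_(i < N.+1) (b i / i%:R).

(** Coefficient i only involves products g_j b_(i + 1 - j). For i < N truncation removes none of
    them and the recursion gives 0; for i >= N at most i + 2 of them survive, each carrying x^(i +
    1) <= x^N. *)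
Lemma coef_logderiv_defect N i :
  normc (((phi N)^`() - phi N * (S N)^`())`_i) <=
    if (i < N)%N then 0 else i.+2%:R * N.+1%:R ^+ B * (B%:R * x ^+ N).
Proof.
have -> : ((phi N)^`() - phi N * (S N)^`())`_i =
    i.+1%:R * (phi N)`_i.+1 - \sum_(j < i.+2) (phi N)`_j * (i.+1 - j)%:R * (S
      N)`_(i.+1 - j).
  rewrite coefB coef_deriv -[X in X - _]mulr_natl coefM; congr (_ - _).
  rewrite [RHS]big_ord_recr /= subnn mulr0 mul0r addr0; apply: eq_bigr => j _.
  by rewrite coef_deriv -[_ *+ _]mulr_natl mulrA subSn // -ltnS.
have SE k : k%:R * (S N)`_k = if (k < N.+1)%N then b k else 0.
  rewrite coef_poly; case: ifP => _; last by rewrite mulr0.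
  have [->|k0] := eqVneq k 0%N; first by rewrite b0 mul0r.
  by rewrite mulrC divfK // pnatr_eq0.
under eq_bigr => j _ do rewrite -mulrA SE.
case: ifP => iN.
  rewrite coef_poly ltnS iN bg convC (eq_bigr (fun j : 'I__ => g j * b (i.+1 - j)%N)).
    by rewrite subrr normc0.
  move=> j _; rewrite coef_poly (leq_ltn_trans (leq_subr _ _)) //.
  by rewrite (leq_trans (ltn_ord j)).
rewrite coef_poly ltnS iN mulr0 sub0r normcNE.
apply: le_trans (ler_normc_sum _ _ _) _.
apply: (@le_trans _ _ (\sum_(j < i.+2) N.+1%:R ^+ B * (B%:R * x ^+ N))); last first.
  by rewrite sumr_const card_ord -[leLHS]mulr_natl mulrA.
have r0 : 0 <= N.+1%:R ^+ B * (B%:R * x ^+ N) by rewrite !mulr_ge0 ?exprn_ge0.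
apply: ler_sum => j _; rewrite coef_poly normcM.
case: ifP => jN; last by rewrite normc0 mul0r.
case: ifP => kN; last by rewrite normc0 mulr0.
apply: (@le_trans _ _ (j.+1%:R ^+ B * x ^+ j * (B%:R * x ^+ (i.+1 - j)))).
  by apply: ler_pM; rewrite ?normc_ge0.
have -> : j.+1%:R ^+ B * x ^+ j * (B%:R * x ^+ (i.+1 - j)) =
    j.+1%:R ^+ B * (B%:R * x ^+ i.+1).
  have -> : x ^+ i.+1 = x ^+ j * x ^+ (i.+1 - j) by rewrite -exprD subnKC // -ltnS.
  by ring.
apply: ler_pM; rewrite ?mulr_ge0 ?exprn_ge0 //.
  by rewrite lerXn2r ?nnegrE // ler_nat.
rewrite ler_wpM2l // ler_wiXn2l // ?ltW //.
by move/negbT: iN; rewrite -leqNgt => /leqW.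
Qed.

(** There are at most 2 (N + 1) coefficients, and i + 2 <= 3 (N + 1) for each: hence the 6 and the
    exponent B + 2. *)
Lemma horner_logderiv_defect N (t : R) : 0 <= t <= 1 ->
  normc (((phi N)^`() - phi N * (S N)^`()).[t%:C]) <=
    6 * B%:R * (N.+1%:R ^+ B.+2 * x ^+ N).
Proof.
move=> /andP[t0 t1]; set D := _ - _.
have sd (p : {poly R[i]}) : (size p <= N.+1)%N -> (size p^`() <= N)%N.
  move=> sp; apply/leq_sizeP => j Nj.
  by rewrite coef_deriv nth_default ?mul0rn // (leq_trans sp).
have sD : (size D <= N.+1 + N.+1)%N.
  apply: leq_trans (size_polyD _ _) _; rewrite size_polyN geq_max; apply/andP; split.
    by apply: leq_trans (sd _ (size_poly _ _)) _; lia.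
  apply: leq_trans (size_polyMleq _ _) _.
  apply: leq_trans (leq_pred _) (leq_add (size_poly _ _) _).
  by apply: leq_trans (sd _ (size_poly _ _)) _.
rewrite (horner_coef_wide _ sD); apply: le_trans (ler_normc_sum _ _ _) _.
apply: (@le_trans _ _ (\sum_(i < N.+1 + N.+1) (3 * N.+1%:R) * N.+1%:R ^+ B * (B%:R * x
  ^+ N))).
  apply: ler_sum => i _; rewrite normcM normcX normc_real (ger0_norm t0).
  apply: (@le_trans _ _ (normc D`_i)).
    by rewrite ler_piMr ?normc_ge0 // exprn_ile1.
  apply: le_trans (coef_logderiv_defect N i) _.
  case: ifP => iN; first by rewrite !mulr_ge0 ?exprn_ge0.
  rewrite ler_wpM2r ?mulr_ge0 ?exprn_ge0 // ler_wpM2r ?exprn_ge0 //.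
  rewrite -natrM ler_nat; have := ltn_ord i; lia.
rewrite sumr_const card_ord -[leLHS]mulr_natl natrD !exprS.
by rewrite le_eqVlt; apply/orP; left; apply/eqP; ring.
Qed.

(* All low coefficients of phi' - phi S' vanish, so that phi e^(- S) is nearly
   constant on [0, 1]. *)
Lemma sum_logderiv_tends :
  tends (fun N => \sum_(k < N.+1) g k - cexp (\sum_(j < N.+1) b j / j%:R)) 0.
Proof.
have p : 0 < 1 - x by rewrite subr_gt0.
pose M := B%:R / (1 - x).
have SM N t : 0 <= t <= 1 -> normc (S N).[t%:C] <= M.
  move=> /andP[t0 t1]; rewrite horner_poly; apply: le_trans (ler_normc_sum _ _ _) _.
  apply: (@le_trans _ _ (B%:R * \sum_(i < N.+1) x ^+ i)); last first.
    by rewrite ler_wpM2l // sum_geometric_le.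
  rewrite mulr_sumr; apply: ler_sum => i _.
  rewrite normcM normcX normc_real (ger0_norm t0).
  apply: (@le_trans _ _ (normc (b i / i%:R))).
    by rewrite ler_piMr ?normc_ge0 // exprn_ile1.
  apply: le_trans (bB i); rewrite normcM normcV normc_nat.
  case: (val i) => [|k]; first by rewrite b0 normc0 mul0r.
  by rewrite ler_piMr ?normc_ge0 // invf_le1 ?ltr0n // ler1n.
have [C [y [C0 y0 y1 HC]]] := poly_geometric_decay B.+2 x0 x1.
(* One e^M bounds e^S at 1, the other e^(- S) along [0, 1]. *)
pose L := expR M * (6 * B%:R * C * expR M).
apply: (@tends_squeeze _ _ _ (fun n => L * y ^+ n)); first exact: cvg_geometric0.
move=> N; rewrite subr0.
have one01 : 0 <= (1 : R) <= 1 by rewrite ler01 lexx.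
pose F t := (phi N).[t%:C] * cexp (- S N).[t%:C].
have F0 : F 0 = 1.
  rewrite /F !horner_coef0 !coefN !coef_poly /= g0 b0 mul0r oppr0 cexp0 mulr1 //.
have F1 : F 1 = (\sum_(k < N.+1) g k) * cexp (- \sum_(j < N.+1) b j / j%:R).
  rewrite /F hornerN !horner_poly; congr (_ * cexp (- _)).
    by apply: eq_bigr => i _; rewrite expr1n mulr1.
  by apply: eq_bigr => i _; rewrite expr1n mulr1.
have -> : \sum_(k < N.+1) g k - cexp (\sum_(j < N.+1) b j / j%:R) =
    cexp (\sum_(j < N.+1) b j / j%:R) * (F 1 - F 0).
  by rewrite F0 F1 mulrBr mulr1 mulrCA [cexp _ * cexp _]mulrC cexpNK mulr1.
rewrite normcM -[leRHS]mulrA; apply: ler_pM; rewrite ?normc_ge0 //.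
  apply: le_trans (normc_cexp_le _) _; rewrite ler_expR.
  have := SM N 1 one01; rewrite horner_poly.
  by under eq_bigr => i _ do rewrite expr1n mulr1.
have HF := qdiffM (qdiff_horner (phi N)) (qdiff_cexp (qdiff_horner (- S N))).
apply: (qdiff_mean_value HF) => t t01.
rewrite (_ : _ + _ = ((phi N)^`() - phi N * (S N)^`()).[t%:C] * cexp (- S N).[t%:C]);
  last first.
  by rewrite derivN hornerD !hornerN hornerM; ring.
rewrite normcM mulrAC; apply: ler_pM; rewrite ?normc_ge0 //.
  apply: le_trans (horner_logderiv_defect N t01) _.
  by rewrite -[leRHS]mulrA ler_wpM2l ?HC // mulr_ge0.
apply: le_trans (normc_cexp_le _) _; rewrite ler_expR hornerN normcNE.
exact: SM.
Qed.

End ExponentialFormula.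

(** * The Gauss product for 1 / Gamma *)

Section TendsMul.
Variable R : realType.
Implicit Types (u v : nat -> R[i]) (l : R[i]).

Lemma tendsM u v l l' : tends u l -> tends v l' -> tends (fun n => u n * v n) (l * l').
Proof.
move=> ul vl.
pose b n := normc (u n - l) * normc (v n - l') + normc l * normc (v n - l')
  + normc l' * normc (u n - l).
apply: (@tends_squeeze _ _ _ b) => [|n].
  have H := cvgD (cvgD (cvgM ul vl) (cvgM (cvg_cst (normc l)) vl))
    (cvgM (cvg_cst (normc l')) ul).
  by rewrite !mulr0 !addr0 in H; exact: H.
rewrite (_ : _ - _ = (u n - l) * (v n - l') + l * (v n - l') + l' * (u n - l));
  last by ring.
rewrite /b -!normcM; apply: le_trans (ler_normcD _ _) _; rewrite lerD2r.
exact: ler_normcD.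
Qed.

Lemma tends_cst l : tends (fun=> l) l.
Proof. by rewrite /tends subrr normc0; exact: cvg_cst. Qed.

Lemma tends_uniq u l l' : tends u l -> tends u l' -> l = l'.
Proof. by move=> /clim_tends <- /clim_tends. Qed.

Lemma tends_shift u l k : tends u l -> tends (fun n => u (n + k)%N) l.
Proof. by move=> ul; rewrite /tends (cvg_shiftn k (fun n => normc (u n - l))). Qed.

Lemma eq_tends u v l : u =1 v -> tends u l -> tends v l.
Proof. by move=> /funext ->. Qed.

Lemma tends_cexp (d : nat -> R) (w : R[i]) : (d @ \oo --> (0 : R))%classic ->
  tends (fun n => cexp (w * (d n)%:C)) 1.
Proof.
move=> d0; pose b n := 5 * (normc w * `|d n|) * expR (5 * (normc w * `|d n|)).
apply: (@tends_squeeze _ _ _ b) => [|n].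
  have H : ((fun n => 5 * (normc w * `|d n|)) @ \oo --> (0 : R))%classic.
    have -> : (0 : R) = 5 * (normc w * `|(0 : R)|) by rewrite normr0 !mulr0.
    exact: (cvgM (cvg_cst _) (cvgM (cvg_cst _) (cvg_norm d0))).
  rewrite -(mul0r (expR 0)); apply: (cvgM H).
  exact: (continuous_cvg _ (@continuous_expR R 0) H).
by apply: le_trans (cexp_taylor1 _) _; rewrite normcM normc_real.
Qed.

End TendsMul.

Section AlmostConstant.
Variable R : realType.
Variables (u : nat -> R[i]) (K : R).
Hypothesis K0 : 0 <= K.
Hypothesis step : forall n,
  normc (u n.+1 - u n) <= K * (n.+1%:R^-1 - n.+2%:R^-1) * normc (u n).

(** The relative increments, of order 1 / n^2, are written as telescoping differences, so the
    product of the factors 1 + increment is at most e^(K (1 - 1 / (n + 1))). *)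
Lemma almost_constant_bounded n : normc (u n) <= normc (u 0%N) * expR K.
Proof.
apply: (@le_trans _ _ (normc (u 0%N) * expR (K * (1 - n.+1%:R^-1)))); last first.
  rewrite ler_wpM2l ?normc_ge0 // ler_expR ler_piMr // lerBlDr lerDl.
elim: n => [|n IH]; first by rewrite invr1 subrr mulr0 expR0 mulr1.
rewrite -[u n.+1](subrK (u n)); apply: le_trans (ler_normcD _ _) _.
apply: (@le_trans _ _ ((1 + K * (n.+1%:R^-1 - n.+2%:R^-1)) * normc (u n))).
  by rewrite mulrDl mul1r addrC lerD2l.
apply: (@le_trans _ _ (expR (K * (n.+1%:R^-1 - n.+2%:R^-1)) *
    (normc (u 0%N) * expR (K * (1 - n.+1%:R^-1))))).
  apply: ler_pM; rewrite ?normc_ge0 ?expR_ge1Dx //.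
  rewrite addr_ge0 // mulr_ge0 // subr_ge0 lef_pV2 ?posrE ?ltr0n // ler_nat.
  exact: leqnSn.
rewrite mulrCA -expRD le_eqVlt; apply/orP; left; apply/eqP.
by congr (_ * expR _); ring.
Qed.

Let L := K * (normc (u 0%N) * expR K).

Lemma almost_constant_cauchy m n : (n <= m)%N -> normc (u m - u n) <= L * n.+1%:R^-1.
Proof.
move=> nm; have L0 : 0 <= L by rewrite !mulr_ge0 ?normc_ge0 ?expR_ge0.
apply: (@le_trans _ _ (L * (n.+1%:R^-1 - m.+1%:R^-1))); last first.
  by rewrite ler_wpM2l // lerBlDr lerDl invr_ge0.
elim: m nm => [|m IH]; first by rewrite leqn0 => /eqP ->; rewrite !subrr normc0 mulr0.
rewrite leq_eqVlt => /predU1P[<-|nm]; first by rewrite !subrr normc0 mulr0.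
apply: le_trans (ler_normc_dist (u m) _ _) _.
have -> : L * (n.+1%:R^-1 - m.+2%:R^-1) =
  L * (m.+1%:R^-1 - m.+2%:R^-1) + L * (n.+1%:R^-1 - m.+1%:R^-1) by ring.
apply: lerD; last exact: IH.
apply: le_trans (step m) _; rewrite /L mulrAC ler_wpM2r //.
  by rewrite subr_ge0 lef_pV2 ?posrE ?ltr0n // ler_nat leqnSn.
by rewrite ler_wpM2l // almost_constant_bounded.
Qed.

Lemma almost_constant_tends :
  exists2 l, tends u l & forall n, normc (u n - l) <= L * n.+1%:R^-1.
Proof.
apply: cauchy_tends; last exact: almost_constant_cauchy.
rewrite -(mulr0 L); exact: (cvgM (cvg_cst L) (@cvg_harmonic R)).
Qed.

End AlmostConstant.

Section LogIncrements.
Variable R : realType.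

Lemma ln_succ_le n : ln n.+2%:R - ln n.+1%:R <= n.+1%:R^-1 :> R.
Proof.
have p (k : nat) : 0 < k.+1%:R :> R by rewrite ltr0n.
rewrite -ln_div ?posrE // -natr1 mulrDl mulfV ?gt_eqF // mul1r.
by apply: le_ln1Dx; apply: lt_le_trans (_ : -1 < 0) _; rewrite ?invr_ge0 // oppr_lt0.
Qed.

Lemma ln_succ_ge n : n.+2%:R^-1 <= ln n.+2%:R - ln n.+1%:R :> R.
Proof.
have p (k : nat) : 0 < k.+1%:R :> R by rewrite ltr0n.
rewrite -[leRHS]opprB lerNr -ln_div ?posrE //.
have -> : n.+1%:R = n.+2%:R - 1 :> R by rewrite -[n.+2%:R]natr1 addrK.
rewrite mulrBl mulfV ?gt_eqF // mul1r; apply: le_ln1Dx.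
by rewrite ltrN2 invf_lt1 // ltr1n.
Qed.

Let harm n : R := \sum_(1 <= k < n.+1) k%:R^-1.

Let harmS n : harm n.+1 = harm n + n.+1%:R^-1.
Proof. by rewrite /harm big_nat_recr. Qed.

Lemma cvg_euler_mascheroni :
  ((fun n => \sum_(1 <= k < n.+1) k%:R^-1 - ln n%:R) @ \oo --> euler_mascheroni R)%classic.
Proof.
rewrite -/(harm _); rewrite -(cvg_shiftS (fun n => harm n - ln n%:R)).
suff H : cvgn (fun n => harm n.+1 - ln n.+1%:R).
  rewrite (_ : euler_mascheroni R = limn (fun n => harm n.+1 - ln n.+1%:R)) //.
  apply: cvg_lim => //; rewrite -(cvg_shiftS (fun n => harm n - ln n%:R)).
  exact: H.
apply: nonincreasing_is_cvgn.
  apply/nonincreasing_seqP => n; rewrite /= (harmS n.+1).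
  rewrite -addrA lerD2l lerBlDr addrC.
  exact: ln_succ_ge.
exists 0 => _ [n _ <-]; rewrite subr_ge0.
apply: (@le_trans _ _ (ln n.+2%:R)).
  by rewrite ler_ln ?posrE ?ltr0n // ler_nat leqnSn.
elim: n => [|n IH].
  have := ln_succ_le 0; rewrite ln1 subr0 /harm big_nat1 //.
rewrite harmS -lerBlDr; apply: le_trans IH; rewrite lerBlDr addrC -lerBlDr.
exact: ln_succ_le.
Qed.

End LogIncrements.

Section GammaLimit.
Variable R : realType.
Implicit Types z : R[i].

(* The Gauss product for 1 / Gamma(z), up to a factor n / (n + z). *)
Definition gauss z n : R[i] := rising z n * cpow n%:R (1 - z).

(** Put w = 1 - z, x = 1 / (n + 2) and l = ln((n + 2) / (n + 1)). The ratio of consecutive terms is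
    (1 - w x) e^(w l), and l = x + O(x^2), so it is 1 + O(x^2). Indices start at 1 to avoid ln 0. *)
Lemma gauss_step (W : R) : 0 <= W -> exists2 K : R, 0 <= K &
  forall z n, normc (1 - z) <= W ->
  normc (gauss z n.+2 - gauss z n.+1) <=
    K * (n.+1%:R^-1 - n.+2%:R^-1) * normc (gauss z n.+1).
Proof.
move=> W0; have e0 := expR_ge0 W.
exists ((1 + W) * (16 * W ^+ 2 * expR W) + 2 * W + 2 * W ^+ 2).
  by rewrite !addr_ge0 ?mulr_ge0 ?sqr_ge0 ?addr_ge0.
move=> z n; set w := 1 - z => wW.
have p (k : nat) : 0 < k.+1%:R :> R by rewrite ltr0n.
pose x : R := n.+2%:R^-1; pose l : R := ln n.+2%:R - ln n.+1%:R.
have x0 : 0 < x by rewrite invr_gt0.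
have x2 : 2 * x <= 1 by rewrite ler_pdivrMr // mul1r ler_nat.
have nE : n.+1%:R^-1 = x / (1 - x).
  rewrite /x; have -> : n.+1%:R = n.+2%:R - 1 :> R by rewrite -[n.+2%:R]natr1 addrK.
  have q : n.+2%:R - 1 != 0 :> R by rewrite -[n.+2%:R]natr1 addrK gt_eqF.
  move: (n.+2%:R) (gt_eqF (p n.+1)) q => a /negbT a0 a1; field.
  by rewrite a1 a0.
have q0 : 0 < 1 - x by lra.
have dE : n.+1%:R^-1 - n.+2%:R^-1 = x ^+ 2 / (1 - x).
  rewrite nE -/x; field; lra.
have lx : x <= l := ln_succ_ge R n.
have lx2 : l - x <= 2 * x ^+ 2.
  have := ln_succ_le R n; rewrite -/l nE => H.
  have : x / (1 - x) <= x + 2 * x ^+ 2.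
    rewrite ler_pdivrMr //; nra.
  lra.
have l0 : 0 <= l by lra.
have l2x : l <= 2 * x by nra.
have l1 : l <= 1 by lra.
have -> : gauss z n.+2 - gauss z n.+1 =
    gauss z n.+1 * ((1 - w * x%:C) * cexp (w * l%:C) - 1).
  rewrite /gauss risingS /cpow -/w.
  have -> : (ln n.+2%:R)%:C = (ln n.+1%:R)%:C + l%:C :> R[i].
    by rewrite -rmorphD /= addrC subrK.
  have -> : (n.+1%:R + z) / n.+2%:R = 1 - w * x%:C :> R[i].
    have : n.+1%:R + 1 != 0 :> R[i] by rewrite natr1 pnatr_eq0.
    rewrite /x fmorphV rmorph_nat -[n.+2%:R]natr1 /w.
    by move: n.+1%:R => a a0; field.
  by rewrite (mulrDr w) cexpD; ring.
rewrite normcM mulrC ler_wpM2r ?normc_ge0 // dE.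
apply: (@le_trans _ _ (((1 + W) * (16 * W ^+ 2 * expR W) + 2 * W + 2 * W ^+ 2) * x ^+
  2)); last first.
  rewrite ler_wpM2l //; first by rewrite !addr_ge0 ?mulr_ge0 ?sqr_ge0 ?addr_ge0.
  by rewrite ler_peMr ?sqr_ge0 // invf_ge1 //; lra.
set v := w * l%:C.
(* The first-order terms w l and w x cancel up to w (l - x). The three terms left are of order x^2
   and yield the three summands of the constant. *)
rewrite (_ : _ - _ = (1 - w * x%:C) * (cexp v - 1 - v) + w * (l - x)%:C - w * x%:C *
  v); last first.
  by rewrite rmorphB /= /v; ring.
apply: le_trans (ler_normcB _ _) _; apply: le_trans (lerD (ler_normcD _ _) (lexx _)) _.
have nx : normc (x%:C) = x by rewrite normc_real ger0_norm // ltW.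
have nl : normc (l%:C) = l by rewrite normc_real ger0_norm.
have nlx : normc ((l - x)%:C) = l - x by rewrite normc_real ger0_norm // subr_ge0.
have w0 := normc_ge0 w.
have nv : normc v <= 2 * W * x.
  by rewrite normcM nl -mulrA [2 * _]mulrCA; apply: ler_pM.
have nvW : normc v <= W by rewrite normcM nl -[leRHS]mulr1; apply: ler_pM.
have A1 : normc (1 - w * x%:C) <= 1 + W.
  apply: le_trans (ler_normcB _ _) _; rewrite normc1 lerD2l normcM nx.
  by rewrite -[leRHS]mulr1; apply: ler_pM => //; lra.
have A2 : normc (cexp v - 1 - v) <= 4 * (2 * W * x) ^+ 2 * expR W.
  apply: le_trans (cexp_taylor2 v) _; apply: ler_pM; rewrite ?expR_ge0 ?ler_expR //.
    by rewrite mulr_ge0 ?sqr_ge0.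
  by rewrite ler_wpM2l // lerXn2r // nnegrE ?normc_ge0 // !mulr_ge0 // ltW.
have A3 : normc ((1 - w * x%:C) * (cexp v - 1 - v)) <= (1 + W) * (4 * (2 * W * x) ^+ 2
  * expR W).
  by rewrite normcM; apply: ler_pM; rewrite ?normc_ge0.
have A4 : normc (w * (l - x)%:C) <= W * (2 * x ^+ 2).
  by rewrite normcM nlx; apply: ler_pM => //; lra.
have A5 : normc (w * x%:C * v) <= W * x * (2 * W * x).
  rewrite !normcM nx -normcM; apply: ler_pM; rewrite ?mulr_ge0 ?normc_ge0 //;
    first exact: ltW.
  by rewrite ler_wpM2r // ltW.
apply: le_trans (lerD (lerD A3 A4) A5) _.
by rewrite le_eqVlt; apply/orP; left; apply/eqP; ring.
Qed.

Lemma gauss1 z : gauss z 1 = z.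
Proof.
by rewrite /gauss /cpow ln1 mulr0 cexp0 mulr1 risingS rising0 invr1 add0r mulr1 mul1r.
Qed.

(** The factors z + 1 + k of the Weierstrass product at z + 1, completed by z (z + 1), form z (z +
    1) ... (z + n + 1) = (n + 2)! [rising z n.+2]. The exponential on the right collects what
    separates the convergence factors from a power of n + 2; its exponent tends to 0. *)
Lemma gauss_inv_Gamma z n :
  z * (z + 1) * (cexp ((euler_mascheroni R)%:C * (z + 1)) *
   \prod_(1 <= k < n.+1) ((1 + (z + 1) / k%:R) * cexp (- ((z + 1) / k%:R)))) =
  gauss z n.+2 * ((n.+1%:R / n.+2%:R) *
    cexp ((z + 1) * (ln n.+2%:R - (\sum_(1 <= k < n.+1) k%:R^-1) + euler_mascheroni R)%:C)).
Proof.
rewrite big_split /= -cexp_sum.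
have -> : \sum_(1 <= k < n.+1) - ((z + 1) / k%:R) =
    - ((z + 1) * (\sum_(1 <= k < n.+1) k%:R^-1)%:C).
  rewrite rmorph_sum mulr_sumr -sumrN; apply: eq_bigr => k _.
  by rewrite fmorphV rmorph_nat.
have P : z * (z + 1) * \prod_(1 <= k < n.+1) (1 + (z + 1) / k%:R) =
    rising z n.+2 * (n.+1%:R * n.+2%:R).
  elim: n => [|n IH].
    rewrite big_geq // !risingS rising0 mul1r add0r divr1 [1 + z]addrC mul1r mulr1.
    by rewrite -mulrA divfK ?pnatr_eq0.
  rewrite big_nat_recr //= mulrA IH [RHS]mulrC (risingS z n.+2).
  have n1 : n.+1%:R != 0 :> R[i] by rewrite pnatr_eq0.
  have n3 : n.+3%:R != 0 :> R[i] by rewrite pnatr_eq0.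
  have -> : 1 + (z + 1) / n.+1%:R = (n.+2%:R + z) / n.+1%:R.
    by rewrite -[n.+2%:R]natr1 -addrA [RHS]mulrDl mulfV // [1 + z]addrC.
  move: (rising z n.+2) (n.+3%:R) (n.+2%:R) (n.+1%:R) n1 n3 => r a c e e0 a0.
  by field; rewrite e0 a0.
have lnn : (n.+2%:R : R[i]) = cexp (ln n.+2%:R)%:C.
  by rewrite cexp_real lnK ?posrE ?ltr0n // rmorph_nat.
have n2 : n.+2%:R != 0 :> R[i] by rewrite pnatr_eq0.
transitivity (rising z n.+2 * n.+1%:R * (n.+2%:R *
    (cexp ((euler_mascheroni R)%:C * (z + 1)) *
     cexp (- ((z + 1) * (\sum_(1 <= k < n.+1) k%:R^-1)%:C))))).
  move: (cexp _) (cexp (- _)) P => e1 e2; move: (\prod_(1 <= k < n.+1) _) => Pr P.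
  have -> : z * (z + 1) * (e1 * (Pr * e2)) = z * (z + 1) * Pr * (e1 * e2) by ring.
  by rewrite P; ring.
have E : cpow n.+2%:R (1 - z) * cexp ((z + 1) *
    (ln n.+2%:R - (\sum_(1 <= k < n.+1) k%:R^-1) + euler_mascheroni R)%:C) =
   n.+2%:R * (n.+2%:R * (cexp ((euler_mascheroni R)%:C * (z + 1)) *
     cexp (- ((z + 1) * (\sum_(1 <= k < n.+1) k%:R^-1)%:C)))).
  rewrite lnn /cpow -!cexpD; congr cexp.
  by rewrite rmorphD rmorphB /=; ring.
rewrite /gauss [RHS]mulrACA E; move: (cexp _ * cexp _) (n.+2%:R) n2 => e a a0.
by field.
Qed.

Lemma tends_gauss_inv_Gamma z l :
  tends (fun n => gauss z n.+1) l -> l = z * inv_Gamma (z + 1).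
Proof.
(* At z = 0 and z = -1 a factor of [rising z n.+2] vanishes and both sides are 0; elsewhere one may
   divide by z (z + 1) to isolate the product under [clim]. *)
move=> gl; have [z0|zn0] := eqVneq (z * (z + 1)) 0.
  rewrite /inv_Gamma !mulrA z0 !mul0r; apply: (tends_uniq (tends_shift 1 gl)).
  apply: (eq_tends _ (tends_cst 0)) => n; rewrite addn1 /gauss.
  suff -> : rising z n.+2 = 0 by rewrite mul0r.
  elim: n => [|n IH]; last by rewrite risingS IH mul0r.
  by rewrite !risingS rising0 add0r mul1r divr1 addrC mulrA z0 mul0r.
pose em := euler_mascheroni R.
pose h n : R := \sum_(1 <= k < n.+1) k%:R^-1.
pose d n : R := ln n.+2%:R - h n + em.
have d0 : (d @ \oo --> (0 : R))%classic.
  have H1 : ((fun n => n.+1%:R^-1 + n.+2%:R^-1 : R) @ \oo --> (0 : R))%classic.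
    rewrite -(addr0 0); apply: cvgD; first exact: cvg_harmonic.
    have := @cvg_harmonic R; rewrite -(cvg_shiftS (@harmonic R)); exact.
  have H2 : ((fun n => h n.+2 - ln n.+2%:R) @ \oo --> em)%classic.
    have := @cvg_euler_mascheroni R.
    rewrite -(cvg_shiftn 2) => H.
    rewrite (_ : (fun _ => _) = (fun n => h (n + 2)%N - ln (n + 2)%:R)); first exact: H.
    by apply/funext => n; rewrite addn2.
  have H := cvgD (cvgB (cvg_cst em) H2) H1; rewrite subrr addr0 in H.
  (* The harmonic sum in [d] stops two terms before n + 2; these two terms tend to 0. *)
  rewrite (_ : d = (fun n => em - (h n.+2 - ln n.+2%:R) + (n.+1%:R^-1 + n.+2%:R^-1))).
    exact: H.
  have hS k : h k.+1 = h k + k.+1%:R^-1 by rewrite /h big_nat_recr.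
  by apply/funext => n; rewrite /d !hS; ring.
have r1 : tends (fun n => n.+1%:R / n.+2%:R : R[i]) 1.
  have H1 : ((fun n => n.+2%:R^-1 : R) @ \oo --> (0 : R))%classic.
    have := @cvg_harmonic R; rewrite -(cvg_shiftS (@harmonic R)); exact.
  apply: (tends_squeeze H1) => n.
  have n2 : n.+2%:R != 0 :> R[i] by rewrite pnatr_eq0.
  rewrite (_ : _ - _ = - n.+2%:R^-1); first by rewrite normcNE normcV normc_nat.
  by apply: (mulIf n2); rewrite mulrBl divfK // mulNr mulVf // -natr1; ring.
have T := tendsM (tends_shift 1 gl) (tendsM r1 (tends_cexp (z + 1) d0)).
rewrite !mulr1 in T.
pose c := cexp (em%:C * (z + 1)).
have c0 : c != 0 := cexp_neq0 _.
have T' := tendsM (tends_cst (z * (z + 1) * c)^-1) T.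
have cl : clim (fun n => \prod_(1 <= k < n.+1)
    ((1 + (z + 1) / k%:R) * cexp (- ((z + 1) / k%:R)))) = (z * (z + 1) * c)^-1 * l.
  apply: clim_tends; apply: eq_tends T' => n; rewrite addn1.
  rewrite -gauss_inv_Gamma (mulrA (z * (z + 1))) mulrA -/em -/c mulVf ?mul1r //.
  by rewrite mulf_neq0.
by rewrite /inv_Gamma cl -/em -/c !mulrA mulfV ?mul1r // mulf_neq0.
Qed.

End GammaLimit.

Section RisingAsymptotics.
Variable R : realType.

(** Here z / Gamma(z + 1) stands for 1 / Gamma(z). The bound covers every k up to n + 1 at the price
    of a power of k + 1, which the geometric decay of g absorbs; the convolution then need not be
    split into small and large k. *)
Lemma rising_asymptotics (W : nat) : exists (B : nat) (C : R), 0 < C /\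
  forall z : R[i], normc z <= W%:R -> normc (1 - z) <= W%:R ->
  normc (z * inv_Gamma (z + 1)) <= C /\
  forall n k, (k <= n.+1)%N ->
    normc (cpow n.+1%:R (1 - z) * rising z (n.+1 - k) - z * inv_Gamma (z + 1))
      <= C * (k.+1%:R ^+ B / n.+1%:R).
Proof.
have W0 : 0 <= W%:R :> R by rewrite ler0n.
have [K K0 HK] := gauss_step W0.
have e0 := expR_ge0 K; pose A : R := W%:R * expR K.
have A0 : 0 <= A by rewrite mulr_ge0.
have KA0 : 0 <= K * A by rewrite mulr_ge0.
have WA0 : 0 <= 5 * W%:R * A by rewrite !mulr_ge0.
pose C := 1 + W%:R + K * A + 5 * W%:R * A.
(* With q = ln((n + 1) / (n + 1 - k)), 5 W comes from e^(5 W q) <= (k + 1)^(5 W) and 2 from q <= (k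
   + 1)^2 / (n + 1). In C, K A is the rate of the Gauss product and 5 W A the price of passing from
   n + 1 - k to n + 1; 1 and W cover k = n + 1 and the size of the limit. *)
exists (5 * W + 2)%N, C; split; first by rewrite /C; lra.
move=> z zW z1W; set l := z * _.
have step n := HK z n z1W.
have [l' Hl' Hb'] := almost_constant_tends K0 step.
have lE : l' = l := tends_gauss_inv_Gamma Hl'.
rewrite {l'}lE gauss1 in Hl' Hb'.
have Hb n : normc (gauss z n.+1 - l) <= K * A * n.+1%:R^-1.
  apply: le_trans (Hb' n) _; rewrite ler_wpM2r ?invr_ge0 // ler_wpM2l //.
  by rewrite ler_wpM2r.
have HA n : normc (gauss z n.+1) <= A.
  apply: le_trans (almost_constant_bounded K0 step n) _.
  by rewrite gauss1 ler_wpM2r.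
have lC : normc l <= W%:R + K * A.
  have := Hb 0%N; rewrite invr1 mulr1 gauss1 normcB => H.
  by rewrite -(subrK z l); apply: le_trans (ler_normcD _ _) _; rewrite addrC lerD.
split; first by apply: le_trans lC _; rewrite /C; lra.
move=> n k kn.
have n0 : 0 < n.+1%:R :> R by rewrite ltr0n.
have k1 : 1 <= k.+1%:R :> R by rewrite ler1n.
have pw_ge1 m : 1 <= k.+1%:R ^+ m :> R by rewrite exprn_ege1.
(* For k = n + 1 the Gauss product would be taken at 0. There the crude bound (n + 1)^W on the power
   is absorbed by (n + 2)^(5 W + 2) / (n + 1). *)
case m_eq : (n.+1 - k)%N => [|m].
  have -> : k = n.+1 by move: kn m_eq; clear; lia.
  rewrite rising0 mulr1; apply: le_trans (ler_normcB _ _) _.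
  have -> : C * (n.+2%:R ^+ (5 * W + 2) / n.+1%:R) =
    (1 + (W%:R + K * A) + 5 * W%:R * A) * (n.+2%:R ^+ (5 * W + 2) / n.+1%:R).
    by rewrite /C; ring.
  have E1 : n.+1%:R ^+ W.+1 <= n.+2%:R ^+ (5 * W + 2) :> R.
    apply: (@le_trans _ _ (n.+2%:R ^+ W.+1)).
      by rewrite lerXn2r ?nnegrE // ler_nat.
    by rewrite ler_weXn2l ?ler1n //; clear; lia.
  have E2 : n.+1%:R ^+ W <= n.+2%:R ^+ (5 * W + 2) / n.+1%:R :> R.
    by rewrite ler_pdivlMr // -exprSr.
  have E3 : 1 <= n.+2%:R ^+ (5 * W + 2) / n.+1%:R :> R.
    by apply: le_trans E2; rewrite exprn_ege1 // ler1n.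
  have E4 : normc (cpow n.+1%:R (1 - z)) <= n.+1%:R ^+ W.
    rewrite /cpow; apply: le_trans (normc_cexp_le _) _; rewrite normcM normc_real.
    rewrite ger0_norm ?ln_ge0 ?ler1n //.
    rewrite -[n.+1%:R in leRHS](@lnK R) ?posrE // -expRM_natl ler_expR.
    by rewrite ler_wpM2r // ln_ge0 // ler1n.
  move: (_ / _) E2 E3 => x E2 E3; rewrite -addrA mulrDl mul1r; apply: lerD.
    exact: le_trans E4 E2.
  apply: le_trans lC _; apply: le_trans (_ : (W%:R + K * A + 5 * W%:R * A) * 1 <= _).
    by rewrite mulr1 lerDl.
  by rewrite ler_wpM2l // !addr_ge0.
have nE : n.+1 = (m.+1 + k)%N by move: kn m_eq; clear; lia.
have m0 : 0 < m.+1%:R :> R by rewrite ltr0n.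
pose q : R := ln n.+1%:R - ln m.+1%:R.
have -> : cpow n.+1%:R (1 - z) * rising z m.+1 - l =
   gauss z m.+1 * (cexp ((1 - z) * q%:C) - 1) + (gauss z m.+1 - l).
  have -> : cpow n.+1%:R (1 - z) = cpow m.+1%:R (1 - z) * cexp ((1 - z) * q%:C).
    by rewrite /cpow -cexpD; congr cexp; rewrite /q rmorphB /=; ring.
  by rewrite /gauss; ring.
(* Both [mk] and [rk] express n + 1 = (m + 1) + k <= (k + 1) (m + 1). *)
have mk : m.+1%:R^-1 <= k.+1%:R / n.+1%:R :> R.
  by rewrite ler_pdivlMr // mulrC ler_pdivrMr // -natrM ler_nat; move: nE; clear; nia.
have qE : q = ln (n.+1%:R / m.+1%:R) by rewrite ln_div ?posrE.
have r1 : n.+1%:R / m.+1%:R = 1 + k%:R / m.+1%:R :> R.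
  by rewrite nE natrD mulrDl mulfV // gt_eqF.
have km0 : 0 <= k%:R / m.+1%:R :> R by rewrite divr_ge0.
have q0 : 0 <= q by rewrite qE ln_ge0 // r1 lerDl.
have q1 : q <= k.+1%:R ^+ 2 / n.+1%:R.
  apply: (@le_trans _ _ (k%:R / m.+1%:R)).
    by rewrite qE r1 le_ln1Dx // (lt_le_trans _ km0) // oppr_lt0.
  by rewrite expr2 -mulrA; apply: ler_pM; rewrite ?invr_ge0 // ler_nat.
have rk : n.+1%:R / m.+1%:R <= k.+1%:R :> R.
  by rewrite ler_pdivrMr // -natrM ler_nat; move: nE; clear; nia.
have eq5 : expR (5 * (W%:R * q)) <= k.+1%:R ^+ (5 * W).
  rewrite mulrA -natrM expRM_natl qE lnK ?posrE ?divr_gt0 //.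
  by rewrite lerXn2r ?nnegrE ?divr_ge0.
have nv : normc ((1 - z) * q%:C) <= W%:R * q.
  by rewrite normcM normc_real ger0_norm // ler_wpM2r.
apply: le_trans (ler_normcD _ _) _.
have T1 : normc (gauss z m.+1 * (cexp ((1 - z) * q%:C) - 1)) <=
    5 * W%:R * A * (k.+1%:R ^+ (5 * W + 2) / n.+1%:R).
  rewrite normcM [5 * _ * A]mulrC -mulrA; apply: ler_pM; rewrite ?normc_ge0 //.
  apply: le_trans (cexp_taylor1 _) _.
  apply: (@le_trans _ _ (5 * (W%:R * (k.+1%:R ^+ 2 / n.+1%:R)) * k.+1%:R ^+ (5 * W))).
    apply: ler_pM; rewrite ?mulr_ge0 ?normc_ge0 ?expR_ge0 //.
      by rewrite ler_wpM2l //; apply: le_trans nv _; rewrite ler_wpM2l.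
    by apply: le_trans eq5; rewrite ler_expR ler_wpM2l.
  by rewrite exprD le_eqVlt; apply/orP; left; apply/eqP; ring.
have T2 : normc (gauss z m.+1 - l) <= K * A * (k.+1%:R ^+ (5 * W + 2) / n.+1%:R).
  apply: le_trans (Hb m) _; rewrite ler_wpM2l //; apply: le_trans mk _.
  rewrite ler_wpM2r ?invr_ge0 // addn2 exprS ler_peMr // ler0n.
apply: le_trans (lerD T1 T2) _; rewrite -mulrDl ler_wpM2r //.
by rewrite /C; lra.
Qed.

End RisingAsymptotics.

(** * Unique factorization in F[t] *)

Section FactorMultiplicity.
Variable F : finFieldType.
Implicit Types p f g : {poly F}.

Lemma size_monic_deg f : f \is monic -> size f = (deg f).+1.
Proof. by move=> /monic_neq0 f0; rewrite /deg prednK // lt0n size_poly_eq0. Qed.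

Lemma monic_degE n f : monic_deg n f = (f \is monic) && (deg f == n).
Proof.
rewrite /monic_deg; case: (boolP (f \is monic)) => // /size_monic_deg ->.
by rewrite eqSS.
Qed.

Lemma monic_irredW p : monic_irred p -> p \is monic.
Proof. by case/andP. Qed.

Lemma monic_irredP p : monic_irred p -> irreducible_poly p.
Proof. by case/andP => _ /irreducibleP. Qed.

Lemma size_monic_irred p : monic_irred p -> (1 < size p)%N.
Proof. by move/monic_irredP; case. Qed.

Lemma deg_monic_irred_gt0 p : monic_irred p -> (0 < deg p)%N.
Proof. by rewrite /deg => /size_monic_irred; case: size => [|[]]. Qed.

Lemma monic_irred_exp p k : monic_irred p -> p ^+ k \is monic.
Proof. by move/monic_irredW => pm; rewrite monic_exp. Qed.

Lemma degM f g : f \is monic -> g \is monic -> deg (f * g) = (deg f + deg g)%N.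
Proof.
move=> fm gm; apply: succn_inj; rewrite -size_monic_deg ?monicMl //.
by rewrite size_monicM ?monic_neq0 // !size_monic_deg // addnS.
Qed.

Lemma degX f k : f \is monic -> deg (f ^+ k) = (k * deg f)%N.
Proof.
move=> fm; elim: k => [|k IH]; first by rewrite expr0 /deg size_poly1.
by rewrite exprS degM ?monic_exp // IH mulSn.
Qed.

Lemma leq_mult p f k : (1 < size p)%N -> f != 0 -> (k <= mult p f)%N = (p ^+ k %| f).
Proof.
move=> p1 f0; have sf : (0 < size f)%N by rewrite lt0n size_poly_eq0.
have [|k0 k0f kE] := @eq_bigmax_cond _
    [pred k : 'I_(size f) | p ^+ k %| f] (fun k : 'I_(size f) => k : nat).
  by apply/card_gt0P; exists (Ordinal sf); rewrite inE /= expr0 dvd1p.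
apply/idP/idP => [km|kf].
  by apply: dvdp_trans k0f; apply: dvdp_exp2l; rewrite -kE.
have ks : (k < size f)%N.
  have p0 : p != 0 by rewrite -size_poly_eq0; case: size p1.
  apply: leq_trans (dvdp_leq f0 kf).
  have pk0 : (0 < size (p ^+ k)%R)%N by rewrite lt0n size_poly_eq0 expf_neq0.
  rewrite -(prednK pk0) ltnS size_exp leq_pmull //.
  by case: (size p) p1 => [|[]].
exact: (@leq_bigmax_cond _ _ (fun k : 'I_(size f) => k : nat) (Ordinal ks)).
Qed.

Lemma eq_thresholds m n : (forall k, (k <= m)%N = (k <= n)%N) -> m = n.
Proof. by move=> H; apply/eqP; rewrite eqn_leq H leqnn -H leqnn. Qed.

Lemma mult_mul p q f k : monic_irred p -> monic_irred q -> f != 0 ->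
  mult q (p ^+ k * f) = (mult q f + (p == q) * k)%N.
Proof.
move=> ip iq f0; have q1 := size_monic_irred iq.
have pk0 : p ^+ k != 0 by rewrite monic_neq0 // monic_irred_exp.
have pf0 : p ^+ k * f != 0 by rewrite mulf_neq0.
apply: eq_thresholds => l; rewrite leq_mult //; case: eqVneq => [pq|pq] /=.
  rewrite pq mulrC dvdp_exp_sub; last by rewrite -size_poly_eq0; case: size q1.
  by rewrite -leq_mult // mul1n leq_subLR addnC.
(* Distinct monic irreducibles are coprime: otherwise one divides the other, they are associated,
   hence equal. *)
rewrite addn0 leq_mult //; apply: Gauss_dvdpr.
apply/coprimep_expl/coprimep_expr.
rewrite (irreducible_poly_coprime _ (monic_irredP iq)); apply: contra pq => qp.
have qeqp : q %= p by apply: (apply_irredp (monic_irredP ip)) => //; rewrite gtn_eqF.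
by move: qeqp; rewrite eqp_monic ?monic_irredW // eq_sym.
Qed.

Lemma exists_monic_irred f : (1 < size f)%N -> exists2 p, monic_irred p & p %| f.
Proof.
have [n] := ubnP (size f); elim: n f => // n IH f fn f1.
have f0 : f != 0 by rewrite -size_poly_eq0; case: size f1.
have lf0 : (lead_coef f)^-1 != 0 by rewrite invr_eq0 lead_coef_eq0.
have [fi|fni] := pselect (irreducible_poly f).
  exists ((lead_coef f)^-1 *: f); last by rewrite dvdpZl.
  apply/andP; split; first by rewrite monicE lead_coefZ mulVf ?lead_coef_eq0.
  apply/irreducibleP; split=> [|q q1]; first by rewrite size_scale.
  rewrite dvdpZr // => qf; apply: eqp_trans (fi.2 q q1 qf) _.
  by rewrite eqp_sym eqp_scale.
have [q [q1 qf qnf]] : exists q : {poly F}, [/\ size q != 1%N, q %| f & ~~ (q %= f)].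
  apply: contrapT => H; apply: fni; split=> // q q1 qf.
  by apply: contrapT => /negP qnf; apply: H; exists q.
have q0 : q != 0 by apply: contraTneq qf => ->; rewrite dvd0p.
have sq : (size q < size f)%N by rewrite ltn_neqAle dvdp_size_eqp // qnf dvdp_leq.
have [||p ip pq] := IH q; first exact: leq_trans sq _.
  by move: q1 q0; rewrite -size_poly_eq0; case: size => [|[]].
by exists p => //; apply: dvdp_trans qf.
Qed.

End FactorMultiplicity.

Section BoundedPolynomials.
Variable F : finFieldType.
Implicit Types (P : pred {poly F}) (p f : {poly F}).

(** The type [{poly_N F}] changes with N; as sequences of plain polynomials, ranges with different
    bounds can be compared, filtered and permuted. *)
Definition polys N P : seq {poly F} :=
  map (fun p : {poly_N F} => p : {poly F}) [seq p : {poly_N F} <- index_enum {: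
    {poly_N F}} | P p].

Lemma mem_polys N P p : (p \in polys N P) = (size p <= N)%N && P p.
Proof.
apply/mapP/andP => [[q] |[pN Pp]]; first by rewrite mem_filter => /andP[Pq _] ->; split.
by exists (NPoly pN) => //; rewrite mem_filter Pp mem_index_enum.
Qed.

Lemma uniq_polys N P : uniq (polys N P).
Proof. by rewrite map_inj_uniq ?filter_uniq ?index_enum_uniq // => p q /val_inj. Qed.

Lemma big_polys (T : Type) (idx : T) (op : T -> T -> T) N P (G : {poly F} -> T) :
  \big[op/idx]_(p : {poly_N F} | P p) G p = \big[op/idx]_(p <- polys N P) G p.
Proof. by rewrite /polys big_map big_filter. Qed.

Definition monics n := polys n.+1 (monic_deg n).
Definition irreds N := polys N (@monic_irred F).

Lemma mem_monics n f : (f \in monics n) = monic_deg n f.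
Proof.
rewrite mem_polys; case: (boolP (monic_deg n f)) => [/andP[_ /eqP ->]|_].
  by rewrite leqnn.
by rewrite andbF.
Qed.

Lemma size_monics n : size (monics n) = (#|F| ^ n)%N.
Proof.
rewrite -(card_npoly F n) cardE -(size_map (fun g : {poly_n F} => 'X^n + val g)).
apply/perm_size/uniq_perm; first exact: uniq_polys.
  by rewrite map_inj_uniq ?enum_uniq // => g h /addrI /val_inj.
move=> f; rewrite mem_monics; apply/idP/mapP => [/andP[fm /eqP sf]|[g _ ->]].
  have fn : (size (f - 'X^n)%R <= n)%N.
    apply/leq_sizeP => j; rewrite leq_eqVlt => /predU1P[<-|nj].
      rewrite coefB coefXn eqxx; move: fm; rewrite monicE /lead_coef sf => /eqP ->.
      by rewrite subrr.
    by rewrite coefB coefXn gtn_eqF // nth_default ?subr0 // sf.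
  by exists (NPoly fn); rewrite ?mem_enum //= addrC subrK.
have sg : (size (val g) < size ('X^n : {poly F}))%N.
  by rewrite size_polyXn ltnS size_npoly.
by rewrite /monic_deg monicE lead_coefDl // lead_coefXn size_polyDl // size_polyXn !eqxx.
Qed.

(** Irreducibles larger than f have multiplicity 0. A common N then serves for both f and p^k f. *)
Lemma Omega_irreds N f : f != 0 -> (size f <= N)%N ->
  Omega f = (\sum_(p <- irreds N) mult p f)%N.
Proof.
move=> f0 fN.
transitivity (\sum_(p : {poly_(size f) F} | monic_irred p) mult p f)%N; first by [].
rewrite (big_polys _ _ (size f) (@monic_irred F) (fun p => mult p f)).
rewrite [RHS](bigID (fun p => size p <= size f)%N) /= [X in (_ + X)%N]big1_seq; last first.
  move=> p /andP[sp]; rewrite mem_polys => /andP[_ ip]; apply/eqP.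
  rewrite -leqn0 leqNgt leq_mult ?size_monic_irred // expr1; apply: contra sp.
  exact: dvdp_leq.
rewrite addn0 -[in RHS]big_filter; apply/esym; apply: perm_big.
apply: uniq_perm; rewrite ?filter_uniq ?uniq_polys // => p.
rewrite mem_filter !mem_polys; have [pf|//] := leqP (size p) (size f).
by rewrite (leq_trans pf fN).
Qed.

Lemma Omega_mul p f k : monic_irred p -> f \is monic -> Omega (p ^+ k * f) = (Omega f
  + k)%N.
Proof.
move=> ip fm; have f0 := monic_neq0 fm; have pm := monic_irred_exp k ip.
have pf0 : p ^+ k * f != 0 by rewrite mulf_neq0 // monic_neq0.
pose N := (size (p ^+ k * f)%R + size f + size p)%N.
rewrite !(@Omega_irreds N) // /N; try lia.
have pN : p \in irreds N by rewrite mem_polys ip andbT /N leq_addl.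
rewrite (eq_big_seq (fun q => mult q f + (p == q) * k)%N) => [|q]; last first.
  by rewrite mem_polys => /andP[_ iq]; rewrite mult_mul.
rewrite big_split /=; congr (_ + _)%N.
rewrite (bigD1_seq p) ?uniq_polys //= eqxx mul1n big1 ?addn0 // => q.
by rewrite eq_sym => /negbTE ->.
Qed.

(** The existence half of unique factorization, counted by degree: one irreducible factor is split
    off at a time. *)
Lemma deg_mult N f : f \is monic -> (size f <= N)%N ->
  deg f = (\sum_(p <- irreds N) mult p f * deg p)%N.
Proof.
have [n] := ubnP (size f); elim: n f => // n IH f fn fm fN.
have f0 := monic_neq0 fm.
have [f1|f1] := leqP (size f) 1.
  rewrite big1_seq => [|p /andP[_]]; first by rewrite /deg; case: size f1 => [|[]].
  rewrite mem_polys => /andP[_ ip].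
  suff -> : mult p f = 0%N by rewrite mul0n.
  apply/eqP; rewrite -leqn0 leqNgt leq_mult ?size_monic_irred // expr1.
  apply/negP => /(dvdp_leq f0) pf.
  by have := leq_trans (size_monic_irred ip) (leq_trans pf f1).
have [p ip pf] := exists_monic_irred f1; have pm := monic_irredW ip.
pose g := f %/ p; have fE : f = p ^+ 1 * g by rewrite expr1 mulrC divpK.
have gm : g \is monic by rewrite -(monicMl _ (monic_irred_exp 1 ip)) -fE.
have fdeg : deg f = (deg p + deg g)%N by rewrite fE expr1 degM.
have sg : (size g < size f)%N.
  by rewrite !size_monic_deg // fdeg ltnS -[ltnLHS]add0n ltn_add2r deg_monic_irred_gt0.
rewrite fdeg (IH g) ?(leq_trans sg) ?(leq_trans (ltnW sg)) //.
have pN : p \in irreds N by rewrite mem_polys ip andbT (leq_trans (dvdp_leq f0 pf)).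
rewrite fE [RHS](eq_big_seq (fun q => mult q g * deg q + (p == q) * deg q)%N) => [|q];
  last first.
  by rewrite mem_polys => /andP[_ iq]; rewrite mult_mul ?monic_neq0 // muln1 mulnDl.
rewrite big_split /= addnC; congr (_ + _)%N.
rewrite (bigD1_seq p) ?uniq_polys //= eqxx mul1n big1 ?addn0 // => q.
by rewrite eq_sym => /negbTE ->.
Qed.

End BoundedPolynomials.

(** * The recursion for M *)

Section DivisorSums.
Variable K : comNzRingType.
Implicit Types (w : nat -> nat -> K) (h : nat -> K).

(* Sum over the factorizations j = (k + 1) d. *)
Definition divsum w j : K := \sum_(d < j.+1) \sum_(k < j | (k.+1 * d == j)%N) w d k.

Lemma big_ord_shrink m n (G : nat -> K) : (m <= n)%N ->
  (forall i, (m <= i)%N -> G i = 0) -> \sum_(i < n) G i = \sum_(i < m) G i.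
Proof.
move=> mn G0; rewrite (big_ord_widen n G mn) [RHS]big_mkcond; apply: eq_bigr => i _.
by case: ltnP => // /G0.
Qed.

(** The index d = 0 is the delicate one: (k + 1) 0 = 0 holds for every k, so at j = 0 the wider
    range picks up the values [w 0 k]. *)
Lemma divsum_widen w j N : (forall k, w 0%N k = 0) -> (j <= N)%N ->
  divsum w j = \sum_(d < N.+1) \sum_(k < N | (k.+1 * d == j)%N) w d k.
Proof.
move=> w0 jN; rewrite /divsum.
rewrite -(@big_ord_shrink j.+1 N.+1 (fun d => \sum_(k < j | (k.+1 * d == j)%N) w d k)) //.
  apply: eq_bigr => d _; rewrite [LHS]big_mkcond [RHS]big_mkcond /=; apply/esym.
  apply: (big_ord_shrink (G := fun k => if (k.+1 * d == j)%N then w d k else 0)) => // k jk.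
  case: eqP => // kd; case: (posnP d) => [->//|d0].
  by move: kd jk d0; clear; nia.
move=> d jd; rewrite big1 // => k /eqP kd.
by move: kd jd; clear; nia.
Qed.

Lemma sum_divsum w h N : (forall k, w 0%N k = 0) ->
  \sum_(j < N.+1) divsum w j * h j =
  \sum_(d < N.+1) \sum_(k < N | (k.+1 * d <= N)%N) w d k * h (k.+1 * d)%N.
Proof.
move=> w0.
under eq_bigr => j _ do rewrite (divsum_widen w0 (ltn_ord j : (j <= N)%N)) mulr_suml.
rewrite exchange_big; apply: eq_bigr => d _ /=.
under eq_bigr => j _ do rewrite big_mkcond mulr_suml.
rewrite exchange_big [RHS]big_mkcond; apply: eq_bigr => k _ /=.
case: ifP => kd.
  rewrite (bigD1 (Ordinal (kd : (k.+1 * d < N.+1)%N))) //= eqxx big1 ?addr0 // => j jk.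
  by case: eqP => [E|]; rewrite ?mul0r //; case/eqP: jk; apply: val_inj.
rewrite big1 // => j _; case: eqP => [E|]; rewrite ?mul0r //.
by have := ltn_ord j; rewrite ltnS -E kd.
Qed.

End DivisorSums.

Section PrimePolynomialCount.
Variable F : finFieldType.

Definition irr_count d :=
  size (polys d.+1 [pred p : {poly F} | monic_irred p & deg p == d]).

Lemma big_irreds (T : Type) (idx : T) (op : Monoid.com_law idx) N (G : nat -> T) :
  \big[op/idx]_(p <- irreds F N.+1) G (deg p) =
  \big[op/idx]_(d < N.+1) \big[op/idx]_(i < irr_count d) G d.
Proof.
rewrite (partition_big (fun p => inord (deg p) : 'I_N.+1) predT) //=.
apply: eq_bigr => d _; rewrite big_const_ord /irr_count.
have dp p : p \in irreds F N.+1 -> (inord (deg p) == d) = (deg p == d).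
  rewrite mem_polys => /andP[pN ip]; rewrite -val_eqE /= inordK //.
  by rewrite -size_monic_deg // monic_irredW.
rewrite big_seq_cond (eq_bigl (fun p => (p \in irreds F N.+1) && (deg p == d))); last first.
  by move=> p; case pI : (p \in _); rewrite //= dp.
rewrite -big_seq_cond (eq_bigr (fun=> G d)) => [|p /eqP -> //].
rewrite -big_filter big_const_seq count_predT; congr (iter _ _ _).
apply/perm_size/uniq_perm; rewrite ?filter_uniq ?uniq_polys // => p.
rewrite mem_filter !mem_polys /=; case: (boolP (monic_irred p)) => [ip|_].
  rewrite size_monic_deg ?monic_irredW // andbT !ltnS andbC.
  by case: eqP => [->|_]; rewrite ?andbF // leqnn -ltnS ltn_ord.
by rewrite !andbF.
Qed.

End PrimePolynomialCount.

Section Recursion.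
Variables (R : realType) (F : finFieldType).
Implicit Types z : R[i].

Lemma M_monics n z : M F n z = \sum_(f <- monics F n) z ^+ Omega f.
Proof.
exact: (big_polys _ _ n.+1 (monic_deg n) (fun f => z ^+ Omega f)).
Qed.

Lemma M0 z : M F 0 z = 1.
Proof.
rewrite M_monics; have: perm_eq (monics F 0) [:: 1].
  apply: uniq_perm => //; first exact: uniq_polys.
  move=> f; rewrite mem_monics monic_degE inE; apply/andP/eqP => [[fm /eqP f0]|->].
    have /size_poly1P[c _ fc] : size f == 1%N by rewrite size_monic_deg // f0.
    by move: fm; rewrite fc monicE lead_coefC => /eqP ->.
  by rewrite monic1 /deg size_poly1.
move/(perm_big _) => ->; rewrite big_seq1.
suff -> : Omega (1 : {poly F}) = 0%N by [].
rewrite (@Omega_irreds F 1) ?oner_eq0 ?size_poly1 // big1_seq // => p.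
rewrite mem_polys => /andP[_ /andP[p1 ip]].
by have := size_monic_irred ip; rewrite ltnNge p1.
Qed.

Lemma M_1 n : M F n (1 : R[i]) = (#|F| ^ n)%:R.
Proof.
rewrite M_monics; under eq_bigr => f _ do rewrite expr1n.
by rewrite big_const_seq count_predT size_monics iter_addr_0.
Qed.

Lemma sum_multiples n k p z : monic_irred p ->
  \sum_(f <- monics F n | p ^+ k %| f) z ^+ Omega f =
  if (k * deg p <= n)%N then z ^+ k * M F (n - k * deg p) z else 0.
Proof.
move=> ip; have pm := monic_irred_exp k ip.
have dpk : deg (p ^+ k) = (k * deg p)%N by rewrite degX // monic_irredW.
case: leqP => kn; last first.
  rewrite big1_seq // => f /andP[/dvdpP[g fE]]; rewrite mem_monics monic_degE => /andP[fm].
  have gm : g \is monic by rewrite -(monicMr _ pm) -fE.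
  by rewrite fE degM // dpk => /eqP E; move: kn; rewrite -E ltnNge leq_addl.
rewrite M_monics mulr_sumr -big_filter.
have /(perm_big _) -> : perm_eq [seq f <- monics F n | p ^+ k %| f]
    [seq p ^+ k * g | g <- monics F (n - k * deg p)].
  apply: uniq_perm; first by rewrite filter_uniq ?uniq_polys.
    by rewrite map_inj_uniq ?uniq_polys // => g h /mulfI -> //; rewrite monic_neq0.
  move=> f; rewrite mem_filter mem_monics monic_degE; apply/andP/mapP.
    move=> [/dvdpP[g fE] /andP[fm /eqP fn]].
    have gm : g \is monic by rewrite -(monicMr _ pm) -fE.
    exists g; rewrite 1?mulrC // mem_monics monic_degE gm -fn fE degM // dpk.
    by rewrite addnK eqxx.
  move=> [g]; rewrite mem_monics monic_degE => /andP[gm /eqP gn] ->.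
  split; first by rewrite dvdp_mulr.
  by rewrite monicMl // gm degM // dpk gn subnKC // eqxx.
rewrite big_map big_seq [RHS]big_seq; apply: eq_bigr => g.
rewrite mem_monics monic_degE => /andP[gm _].
by rewrite Omega_mul // exprD mulrC.
Qed.

(** Turns [mult p f] into the number of k with p^(k + 1) dividing f. *)
Lemma sum_nat_lt m n : (m <= n)%N -> (\sum_(k < n) (k < m) = m)%N.
Proof.
move=> mn; suff -> : (\sum_(k < n) (k < m) = minn n m)%N by apply/minn_idPr.
elim: n {mn} => [|n IH]; first by rewrite big_ord0 min0n.
by rewrite big_ord_recr /= IH; clear; lia.
Qed.

Definition prime_weight z d k : R[i] := (irr_count F d * d)%:R * z ^+ k.+1.

(** The c_j of the overview: a von Mangoldt function in which p^(k + 1) has the extra weight z^(k +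
    1), with the irreducibles grouped by degree. *)
Definition lambda z j := divsum (prime_weight z) j.

Lemma prime_weight0 z k : prime_weight z 0 k = 0.
Proof. by rewrite /prime_weight muln0 mul0r. Qed.

(* Summing [deg f = \sum_(p, k >= 1, p ^ k | f) deg p] over the monic f of degree n. *)
Lemma logderiv_M z : logderiv (lambda z) (fun n => M F n z).
Proof.
move=> n; rewrite /conv /lambda (sum_divsum (fun j => M F (n - j) z));
  last exact: prime_weight0.
transitivity (\sum_(p <- irreds F n.+1) \sum_(k < n | (k.+1 * deg p <= n)%N)
    (deg p)%:R * z ^+ k.+1 * M F (n - k.+1 * deg p) z); last first.
  rewrite (big_irreds F _ n (fun d => \sum_(k < n | (k.+1 * d <= n)%N)
    d%:R * z ^+ k.+1 * M F (n - k.+1 * d) z)); apply: eq_bigr => d _.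
  rewrite sumr_const card_ord -[LHS]mulr_natl mulr_sumr; apply: eq_bigr => k _.
  by rewrite /prime_weight natrM !mulrA.
transitivity (\sum_(p <- irreds F n.+1) \sum_(k < n)
    (deg p)%:R * \sum_(f <- monics F n | p ^+ k.+1 %| f) z ^+ Omega f); last first.
  apply: eq_big_seq => p; rewrite mem_polys => /andP[_ ip].
  rewrite [RHS]big_mkcond; apply: eq_bigr => k _; rewrite sum_multiples //.
  by case: ifP; rewrite ?mulr0 // mulrA.
rewrite M_monics mulr_sumr.
transitivity (\sum_(f <- monics F n) \sum_(p <- irreds F n.+1) \sum_(k < n)
    (deg p)%:R * (if p ^+ k.+1 %| f then z ^+ Omega f else 0)); last first.
  rewrite exchange_big; apply: eq_bigr => p _ /=.
  rewrite exchange_big; apply: eq_bigr => k _ /=.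
  by rewrite -mulr_sumr -big_mkcond.
apply: eq_big_seq => f; rewrite mem_monics => /andP[fm /eqP sf].
have fn : deg f = n by rewrite /deg sf.
have f0 := monic_neq0 fm.
rewrite -{1}fn (deg_mult fm (_ : size f <= n.+1)%N) ?sf // natr_sum mulr_suml.
apply: eq_big_seq => p; rewrite mem_polys => /andP[_ ip].
have mn : (mult p f <= n)%N.
  by apply/bigmax_leqP => k _; rewrite -ltnS -sf.
rewrite -{1}(sum_nat_lt mn) natrM natr_sum mulrAC mulr_suml mulr_suml.
apply: eq_bigr => k _; rewrite leq_mult ?size_monic_irred //.
by case: (_ %| _); rewrite ?mul1r ?mul0r ?mulr0 // mulrC.
Qed.

End Recursion.

(** * Weights of the prime powers *)

Section LogDerivativeInjective.
Variable K : numFieldType.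

(** As g 0 = 1, the identity at n can be solved for b n. This is how the known counts at z = 1
    determine the prime weights. *)
Lemma logderiv_inj (b b' g : nat -> K) : logderiv b g -> logderiv b' g ->
  g 0%N = 1 -> b =1 b'.
Proof.
move=> bg bg' g0; elim/ltn_ind => n IH.
have := bg n; rewrite bg' /conv !big_ord_recr /= subnn g0 !mulr1.
rewrite [X in X + _](eq_bigr (fun i : 'I_n => b i * g (n - i)%N)) => [|i _].
  by move/addrI => ->.
by rewrite IH.
Qed.

End LogDerivativeInjective.

Section PrimeWeights.
Variables (R : realType) (F : finFieldType).
Implicit Types z : R[i].

Let q := #|F|.

Lemma card_field_gt1 : (1 < q)%N.
Proof. exact: finNzRing_gt1. Qed.

(** Gauss's formula that q^j is the sum of d [irr_count F d] over d | j, read off from 1 / (1 - q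
    u). *)
Lemma lambda_1 j : lambda F (1 : R[i]) j = posc 1 j * q%:R ^+ j.
Proof.
move: j; apply: (@logderiv_inj _ _ _ (fun n => q%:R ^+ n)) => //.
  apply: (eq_logderiv _ _ (logderiv_M F (1 : R[i]))) => // n.
  by rewrite M_1 natrX.
exact: logderiv_geometric.
Qed.

Lemma irr_count_le d : (irr_count F d * d <= q ^ d)%N.
Proof.
case: d => [|d]; first by rewrite muln0.
have := lambda_1 d.+1; rewrite /posc !mul1r -natrX => E.
(* All terms at z = 1 are nonnegative; only the one of the irreducibles of degree d + 1 themselves
   (k = 0) is kept. *)
rewrite -(ler_nat R[i]) -E /lambda /divsum.
rewrite big_ord_recr /= ler_wpDl ?sumr_ge0 // => [i _|].
  by apply: sumr_ge0 => k _; rewrite /prime_weight expr1n mulr1 ler0n.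
rewrite (bigD1 ord0) /= ?mul1n // ler_wpDr ?sumr_ge0 // => [k _|].
  by rewrite /prime_weight expr1n mulr1 ler0n.
by rewrite /prime_weight expr1n mulr1.
Qed.

Lemma irr_count0 : irr_count F 0 = 0%N.
Proof.
rewrite /irr_count; case E : (polys _ _) => [//|p s].
have : p \in polys 1 [pred p : {poly F} | monic_irred p & deg p == 0%N].
  by rewrite E mem_head.
rewrite mem_polys /= => /and3P[_ /deg_monic_irred_gt0 d0 /eqP d1].
by rewrite d1 in d0.
Qed.

(** The weight of p^(k + 1) minus z times its weight at z = 1. It vanishes at k = 0, so the
    irreducibles themselves drop out. *)
Definition excess_weight z d k : R[i] := (irr_count F d * d)%:R * (z ^+ k.+1 - z).

Definition excess z j : R[i] := divsum (excess_weight z) j * q%:R^-1 ^+ j.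

Lemma excess_weight0 z k : excess_weight z 0 k = 0.
Proof. by rewrite /excess_weight muln0 mul0r. Qed.

Lemma lambda_excess z j : lambda F z j * q%:R^-1 ^+ j = posc z j + excess z j.
Proof.
have q0 : q%:R ^+ j != 0 :> R[i].
  by rewrite expf_neq0 // pnatr_eq0 -lt0n ltnW // card_field_gt1.
have -> : posc z j = z * lambda F 1 j * q%:R^-1 ^+ j.
  by rewrite lambda_1 exprVn mulrA mulfK // /posc mulr1 mulrC.
rewrite /excess -mulrDl; congr (_ * _).
rewrite /lambda /divsum mulr_sumr -big_split; apply: eq_bigr => d _ /=.
rewrite mulr_sumr -big_split; apply: eq_bigr => k _ /=.
rewrite /prime_weight /excess_weight expr1n; ring.
Qed.

Variables (A rho : R).
Hypotheses (A1 : 1 <= A) (rhoE : A = (rho ^+ 2) ^+ 2 * q%:R).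
Hypotheses (rho0 : 0 <= rho) (rho1 : rho < 1).

Let q0 : 0 < q%:R :> R. Proof. by rewrite ltr0n ltnW // card_field_gt1. Qed.
Let t := rho ^+ 2.
Let t0 : 0 <= t. Proof. exact: sqr_ge0. Qed.
Let t1 : t <= 1. Proof. by rewrite exprn_ile1 // ltW. Qed.

(** Multiplying the left side by A^(k (d - 1)) >= 1, with A = t^2 q, gives q the exponent it has on
    the right. The exponent of t becomes 2 + 2 k d, which is at least (k + 1) d because k >= 1. *)
Lemma excess_term_aux d k : (0 < d)%N -> (0 < k)%N ->
  q%:R ^+ d * A ^+ k.+1 <= q%:R * t ^+ (k.+1 * d) * q%:R ^+ (k.+1 * d).
Proof.
case: d => // d _ k0; rewrite rhoE -/t exprMn -exprM.
have e1 : 1 <= (t ^+ 2 * q%:R) ^+ (k * d) by rewrite exprn_ege1 // -rhoE.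
rewrite exprMn -exprM in e1.
have qp m : 0 <= q%:R ^+ m :> R by rewrite exprn_ge0 // ltW.
have -> : q%:R * t ^+ (k.+1 * d.+1) * q%:R ^+ (k.+1 * d.+1) =
    t ^+ (k.+1 * d.+1) * q%:R ^+ (k * d) * q%:R ^+ (d.+1 + k.+1).
  rewrite mulrAC -exprS [LHS]mulrC -[RHS]mulrA -exprD; congr (_ * _ ^+ _).
  by clear; lia.
have -> : q%:R ^+ d.+1 * (t ^+ (2 * k.+1) * q%:R ^+ k.+1) =
    t ^+ (2 * k.+1) * q%:R ^+ (d.+1 + k.+1) by rewrite exprD mulrCA.
rewrite ler_wpM2r //.
apply: (@le_trans _ _ (t ^+ (2 * k.+1) * (t ^+ (2 * (k * d)) * q%:R ^+ (k * d)))).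
  by rewrite ler_peMr ?exprn_ge0.
rewrite mulrA -exprD ler_wpM2r // ler_wiXn2l //.
by move: k0; clear; nia.
Qed.

Lemma excess_term_le z d k : normc z <= A ->
  normc (excess_weight z d k * q%:R^-1 ^+ (k.+1 * d)) <=
    2 * q%:R * (rho ^+ (k.+1 * d) * (rho ^+ d * rho ^+ k)).
Proof.
move=> zA; have r0 : 0 <= 2 * q%:R * (rho ^+ (k.+1 * d) * (rho ^+ d * rho ^+ k)).
  by rewrite !mulr_ge0 ?exprn_ge0 // ltW.
case: (posnP d) r0 => [->|d0] r0; first by rewrite excess_weight0 mul0r normc0.
case: (posnP k) r0 => [->|k0] r0.
  by rewrite /excess_weight expr1 subrr mulr0 mul0r normc0.
rewrite normcM normcX normcV normc_nat exprVn ler_pdivrMr ?exprn_gt0 //.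
apply: (@le_trans _ _ (2 * (q%:R ^+ d * A ^+ k.+1))).
  rewrite /excess_weight normcM normc_nat mulrCA; apply: ler_pM; rewrite ?normc_ge0 //.
    by rewrite -natrX ler_nat irr_count_le.
  apply: le_trans (ler_normcB _ _) _; rewrite normcX.
  have zk : normc z ^+ k.+1 <= A ^+ k.+1 by rewrite lerXn2r // nnegrE ?normc_ge0 //
    (le_trans _ A1).
  have Ak : A <= A ^+ k.+1 by rewrite exprS ler_peMr ?exprn_ege1 // (le_trans _ A1).
  by lra.
rewrite -!mulrA ler_wpM2l //; apply: le_trans (excess_term_aux d0 k0) _.
rewrite !mulrA ler_wpM2r ?exprn_ge0 // -!mulrA ler_wpM2l //.
(* Of the two copies of rho^((k + 1) d), one keeps the decay in the total degree and the other is
   traded for rho^d rho^k. *)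
rewrite /t -exprM mulnC muln2 -addnn exprD ler_wpM2l ?exprn_ge0 //.
rewrite -exprD ler_wiXn2l //; last first.
  by move: d0; clear; nia.
exact: ltW.
Qed.

Lemma sum_two_geometric m n :
  \sum_(d < m) \sum_(k < n) rho ^+ d * rho ^+ k <= (1 - rho) ^- 2.
Proof.
have -> : \sum_(d < m) \sum_(k < n) rho ^+ d * rho ^+ k =
    (\sum_(d < m) rho ^+ d) * (\sum_(k < n) rho ^+ k).
  by rewrite mulr_suml; apply: eq_bigr => d _; rewrite mulr_sumr.
rewrite -exprVn expr2; apply: ler_pM; rewrite ?sum_geometric_le //.
  by apply: sumr_ge0 => i _; rewrite exprn_ge0.
by apply: sumr_ge0 => i _; rewrite exprn_ge0.
Qed.

Variable B : R.
Hypothesis (BE : 2 * q%:R * (1 - rho) ^- 2 <= B).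

(** Stated for a general region [P] and weight [h] to serve twice: for one total degree with [h] =
    1, and for a tail of the logarithmic series with h(j) = 1 / j. *)
Lemma sum_excess_le z m n N (P : nat -> nat -> bool) (h : nat -> R[i]) : normc z <= A ->
  (forall j, normc (h j) <= 1) ->
  (forall d k, P d k -> (0 < d)%N -> (N <= k.+1 * d)%N) ->
  normc (\sum_(d < m) \sum_(k < n | P d k)
    excess_weight z d k * (q%:R^-1 ^+ (k.+1 * d) * h (k.+1 * d)%N)) <= B * rho ^+ N.
Proof.
move=> zA h1 PN.
apply: (@le_trans _ _ (2 * q%:R * rho ^+ N * \sum_(d < m) \sum_(k < n) rho ^+ d * rho
  ^+ k)); last first.
  rewrite mulrAC ler_wpM2r ?exprn_ge0 //; apply: le_trans BE.
  by rewrite ler_wpM2l ?sum_two_geometric // mulr_ge0 // ltW.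
rewrite mulr_sumr; apply: le_trans (ler_normc_sum _ _ _) _; apply: ler_sum => d _.
rewrite mulr_sumr big_mkcond /=; apply: le_trans (ler_normc_sum _ _ _) _.
apply: ler_sum => k _.
have r0 : 0 <= 2 * q%:R * rho ^+ N * (rho ^+ d * rho ^+ k).
  by rewrite !mulr_ge0 ?exprn_ge0 // ltW.
case: ifP => [Pdk|_]; last by rewrite normc0.
case: (posnP d) => [d0|d0]; first by move: r0; rewrite d0 excess_weight0 mul0r normc0.
rewrite [X in normc X]mulrA [leLHS]normcM.
apply: (@le_trans _ _ (normc (excess_weight z d k * q%:R^-1 ^+ (k.+1 * d)))).
  by rewrite ler_piMr ?normc_ge0.
apply: le_trans (excess_term_le d k zA) _.
rewrite -[leRHS]mulrA ler_wpM2l ?mulr_ge0 // ler_wpM2r ?mulr_ge0 ?exprn_ge0 //.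
by rewrite ler_wiXn2l ?PN //; exact: ltW.
Qed.

Lemma excess_le z j : normc z <= A -> normc (excess z j) <= B * rho ^+ j.
Proof.
move=> zA; apply: le_trans (@sum_excess_le z j.+1 j j
    (fun d k => (k.+1 * d == j)%N) (fun=> 1) zA _ _); last 2 first.
- by move=> _; rewrite normc1.
- by move=> d k /eqP ->.
rewrite /excess /divsum mulr_suml le_eqVlt; apply/orP; left; apply/eqP; congr normc.
apply: eq_bigr => d _; rewrite mulr_suml; apply: eq_bigr => k /eqP ->.
by rewrite mulr1.
Qed.

End PrimeWeights.

(** * The Euler product *)

Section ComplexLogarithm.
Variable R : realType.
Implicit Types (w z : R[i]) (x : R).

Lemma subr1_neq0 w : normc w < 1 -> 1 - w != 0.
Proof.
move=> w1; rewrite subr_eq0; apply/eqP => E.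
by move: w1; rewrite -E normc1 ltxx.
Qed.

Lemma geometric_sum_tends w : normc w < 1 ->
  tends (fun N => \sum_(k < N) w ^+ k) (1 - w)^-1.
Proof.
move=> w1; have w0 := subr1_neq0 w1; have n0 := normc_ge0 w.
apply: (@tends_squeeze _ _ _ (fun N => normc (1 - w)^-1 * normc w ^+ N)).
  exact: cvg_geometric0.
move=> N; rewrite -normcX -normcM le_eqVlt; apply/orP; left; apply/eqP.
rewrite -[RHS]normcNE; congr normc; apply: (mulfI w0).
have E : (1 - w) * \sum_(k < N) w ^+ k = 1 - w ^+ N.
  by rewrite -opprB mulNr -subrX1 opprB.
by rewrite mulrBr E mulfV // mulrN mulrA mulfV // mul1r; ring.
Qed.

(** The exponential formula for 1 / (1 - w u), with B = 1 and the partial sums taken at u = 1. *)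
Lemma exp_log_series_tends w : normc w < 1 ->
  tends (fun N => cexp (\sum_(k < N) w ^+ k.+1 / k.+1%:R)) (1 - w)^-1.
Proof.
move=> w1; have n0 := normc_ge0 w.
have T := @sum_logderiv_tends R (fun i => posc 1 i * w ^+ i) (fun i => w ^+ i) 1 (normc w)
  n0 w1 (logderiv_geometric w) (expr0 w) _.
have {}T : tends (fun N => \sum_(k < N.+1) w ^+ k - cexp (\sum_(k < N) w ^+ k.+1 /
  k.+1%:R)) 0.
  apply: eq_tends (T _) => [N|[|j]]; last 2 first.
  - by rewrite /posc !mul0r normc0 !mul1r.
  - by rewrite /posc !mul1r normcX.
  congr (_ - cexp _); rewrite big_ord_recl /posc !mul0r add0r.
  by apply: eq_bigr => k _; rewrite !mul1r.
have G := tends_shift 1 (geometric_sum_tends w1).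
pose b N := normc (\sum_(k < N + 1) w ^+ k - (1 - w)^-1) +
  normc (\sum_(k < N.+1) w ^+ k - cexp (\sum_(k < N) w ^+ k.+1 / k.+1%:R) - 0).
apply: (@tends_squeeze _ _ _ b) => [|N].
  by have H := cvgD G T; rewrite addr0 in H; exact: H.
rewrite /b subr0 addn1 normcB; apply: le_trans (ler_normc_dist (\sum_(k < N.+1) w ^+
  k) _ _) _.
by rewrite normcB.
Qed.

Lemma cpow_log_series_tends x z : 0 <= x -> x < 1 ->
  tends (fun N => cexp (- z * (\sum_(k < N) x ^+ k.+1 / k.+1%:R)%:C)) (cpow (1 - x) z).
Proof.
move=> x0 x1; have p : 0 < 1 - x by rewrite subr_gt0.
pose L N := \sum_(k < N) x ^+ k.+1 / k.+1%:R.
have eL : ((fun N => expR (L N)) @ \oo --> (1 - x)^-1)%classic.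
  have /exp_log_series_tends : normc x%:C < 1 by rewrite normc_real ger0_norm.
  rewrite /tends => H; apply/(@cvgrPdist_lt R R^o) => e e0.
  move/(@cvgrPdist_lt R R^o): H => /(_ e e0); apply: filterS => N.
  rewrite sub0r normrN ger0_norm ?normc_ge0 //.
  have -> : \sum_(k < N) x%:C ^+ k.+1 / k.+1%:R = (L N)%:C.
    rewrite /L rmorph_sum; apply: eq_bigr => k _ /=.
    by rewrite rmorphM rmorphXn fmorphV rmorph_nat.
  have -> : (1 - x%:C)^-1 = ((1 - x)^-1)%:C by rewrite fmorphV rmorphB.
  by rewrite cexp_real -rmorphB normc_real distrC.
have Lln : ((fun N => L N + ln (1 - x)) @ \oo --> (0 : R))%classic.
  rewrite -(addNr (ln (1 - x))) -lnV ?posrE //; apply: cvgD; last exact: cvg_cst.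
  have -> : L = (fun N => ln (expR (L N))) by apply/funext => N; rewrite expRK.
  by apply: (continuous_cvg _ _ eL); apply: continuous_ln; rewrite invr_gt0.
have T := tendsM (tends_cst (cpow (1 - x) z)) (tends_cexp (- z) Lln).
rewrite mulr1 in T; apply: eq_tends T => N.
by rewrite /cpow -cexpD; congr cexp; rewrite rmorphD /=; ring.
Qed.

Lemma tends_prod (I : Type) (s : seq I) (u : I -> nat -> R[i]) (l : I -> R[i]) :
  (forall i, tends (u i) (l i)) ->
  tends (fun n => \prod_(i <- s) u i n) (\prod_(i <- s) l i).
Proof.
move=> ul; elim: s => [|i s IH].
  by rewrite big_nil; apply: eq_tends (tends_cst 1) => n; rewrite big_nil.
rewrite big_cons; apply: eq_tends (tendsM (ul i) IH) => n.
by rewrite big_cons.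
Qed.

End ComplexLogarithm.

Section EulerProduct.
Variables (R : realType) (F : finFieldType) (z : R[i]) (A rho B : R).
Let q := #|F|.
Hypotheses (A1 : 1 <= A) (Aq : A < q%:R) (rhoE : A = (rho ^+ 2) ^+ 2 * q%:R).
Hypotheses (rho0 : 0 <= rho) (rho1 : rho < 1).
Hypothesis (BE : 2 * q%:R * (1 - rho) ^- 2 <= B).
Hypothesis zA : normc z <= A.

Definition euler_factor_deg d : R[i] :=
  cpow (1 - (q ^ d)%:R^-1) z * (1 - z / (q ^ d)%:R)^-1.

(** Partial sum of z log(1 - q^(- d)) - log(1 - z q^(- d)). *)
Definition log_euler_factor d K : R[i] :=
  \sum_(k < K) (z ^+ k.+1 - z) * q%:R^-1 ^+ (k.+1 * d) / k.+1%:R.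

Lemma euler_factor_deg_tends d : (0 < d)%N ->
  tends (fun K => cexp (log_euler_factor d K)) (euler_factor_deg d).
Proof.
move=> d0; have q1 := card_field_gt1 F; rewrite -/q in q1.
have qd : (q <= q ^ d)%N by rewrite -[leqLHS]expn1 leq_exp2l.
pose x : R := (q ^ d)%:R^-1.
have qd0 : 0 < (q ^ d)%:R :> R by rewrite ltr0n (leq_trans _ qd) // ltnW.
have x0 : 0 <= x by rewrite invr_ge0 ltW.
have x1 : x < 1 by rewrite invf_lt1 // ltr1n (leq_trans q1).
have zx1 : normc (z / (q ^ d)%:R) < 1.
  rewrite normcM normcV normc_nat ltr_pdivrMr // mul1r.
  by apply: le_lt_trans zA (lt_le_trans Aq _); rewrite ler_nat.
have T := tendsM (cpow_log_series_tends z x0 x1) (exp_log_series_tends zx1).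
apply: eq_tends T => K; rewrite -cexpD; congr cexp.
rewrite /log_euler_factor rmorph_sum mulr_sumr -big_split; apply: eq_bigr => k _ /=.
rewrite rmorphM rmorphXn !fmorphV !rmorph_nat exprMn.
have -> : (q%:R : R[i])^-1 ^+ (k.+1 * d) = (q ^ d)%:R^-1 ^+ k.+1.
  by rewrite natrX -exprVn -exprM mulnC.
ring.
Qed.

Lemma prod_euler_factor N :
  \prod_(p : {poly_N.+1 F} | monic_irred p) euler_factor z p =
  \prod_(d < N.+1) \prod_(i < irr_count F d) euler_factor_deg d.
Proof.
rewrite (big_polys _ _ N.+1 (@monic_irred F) (fun p => euler_factor z p)).
exact: (big_irreds F _ N euler_factor_deg).
Qed.

Definition log_sum N : R[i] := \sum_(j < N.+1) excess F z j / j%:R.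

Definition log_prod N K : R[i] :=
  \sum_(d < N.+1) \sum_(i < irr_count F d) log_euler_factor d K.

Lemma prod_euler_factor_tends N :
  tends (fun K => cexp (log_prod N K))
    (\prod_(p : {poly_N.+1 F} | monic_irred p) euler_factor z p).
Proof.
rewrite prod_euler_factor.
have T := @tends_prod R _ (index_enum 'I_N.+1)
  (fun d K => \prod_(i < irr_count F d) cexp (log_euler_factor d K))
  (fun d => \prod_(i < irr_count F d) euler_factor_deg d) _.
apply: eq_tends (T _) => [K|d].
  by rewrite /log_prod cexp_sum; apply: eq_bigr => d _; rewrite [RHS]cexp_sum.
apply: tends_prod => i; apply: euler_factor_deg_tends.
case: (posnP d) => // d0; suff : false by [].
by move: (leq_ltn_trans (leq0n i) (ltn_ord i)); rewrite d0 irr_count0.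
Qed.

Lemma inv_nat_le1 j : normc ((j%:R : R[i])^-1) <= 1.
Proof.
rewrite normcV normc_nat; case: j => [|j]; first by rewrite invr0.
by rewrite invf_le1 ?ltr0n // ler1n.
Qed.

Lemma log_prodE N K : log_prod N K = \sum_(d < N.+1) \sum_(k < K)
  excess_weight F z d k * (q%:R^-1 ^+ (k.+1 * d) * (k.+1 * d)%:R^-1).
Proof.
apply: eq_bigr => d _; rewrite sumr_const card_ord.
case: (posnP d) => [d0|d0].
  rewrite d0 irr_count0 mulr0n big1 // => k _; by rewrite excess_weight0 mul0r.
rewrite -[LHS]mulr_natl mulr_sumr; apply: eq_bigr => k _.
have dn0 : (d : nat)%:R != 0 :> R[i] by rewrite pnatr_eq0 -lt0n.
have kn0 : k.+1%:R != 0 :> R[i] by rewrite pnatr_eq0.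
rewrite /excess_weight !natrM invfM.
move: (_ ^+ (k.+1 * d)) (k.+1%:R) kn0 => u v v0.
by field; rewrite v0 dn0.
Qed.

Lemma log_sumE N : log_sum N = \sum_(d < N.+1) \sum_(k < N | (k.+1 * d <= N)%N)
  excess_weight F z d k * (q%:R^-1 ^+ (k.+1 * d) * (k.+1 * d)%:R^-1).
Proof.
rewrite -(sum_divsum (fun j => q%:R^-1 ^+ j * j%:R^-1)); last exact: excess_weight0.
by apply: eq_bigr => j _; rewrite /excess mulrA.
Qed.

(** Both are partial sums of one double series over prime powers, one cut by the degree of the prime
    and by k, the other by total degree. They differ by terms with (k + 1) d > N, and the bound is
    uniform in K. *)
Lemma log_prod_sum N K : (N <= K)%N ->
  normc (log_prod N K - log_sum N) <= B * rho ^+ N.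
Proof.
move=> NK.
apply: le_trans (@sum_excess_le R F A rho A1 rhoE rho0 rho1 B BE z N.+1 K N
    (fun d k => (N < k.+1 * d)%N) (fun j => j%:R^-1) zA inv_nat_le1 _); last first.
  by move=> d k /ltnW.
rewrite le_eqVlt; apply/orP; left; apply/eqP; congr normc.
rewrite log_prodE log_sumE -sumrB; apply: eq_bigr => d _.
case: (posnP d) => [d0|d0].
  by rewrite !big1 ?subrr // => k _; rewrite d0 excess_weight0 mul0r.
rewrite (bigID (fun k : 'I_K => (k.+1 * d <= N)%N)) /=.
have -> : \sum_(k < N | (k.+1 * d <= N)%N)
    excess_weight F z d k * (q%:R^-1 ^+ (k.+1 * d) * (k.+1 * d)%:R^-1) =
  \sum_(k < K | (k.+1 * d <= N)%N)
    excess_weight F z d k * (q%:R^-1 ^+ (k.+1 * d) * (k.+1 * d)%:R^-1).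
  rewrite big_mkcond [RHS]big_mkcond; apply/esym.
  apply: (big_ord_shrink (G := fun k => if (k.+1 * d <= N)%N then
    excess_weight F z d k * (q%:R^-1 ^+ (k.+1 * d) * (k.+1 * d)%:R^-1) else 0)) => // k Nk.
  by case: ifP => // kd; move: kd Nk d0; clear; nia.
rewrite addrAC subrr add0r; apply: eq_bigl => k.
by rewrite ltnNge.
Qed.

Let B0 : 0 <= B.
Proof.
apply: le_trans BE; rewrite !mulr_ge0 // invr_ge0 exprn_ge0 // subr_ge0.
exact: ltW.
Qed.

Lemma normc_log_sum N : normc (log_sum N) <= B / (1 - rho).
Proof.
apply: (@le_trans _ _ (B * \sum_(j < N.+1) rho ^+ j)); last first.
  by rewrite ler_wpM2l // sum_geometric_le.
rewrite mulr_sumr; apply: le_trans (ler_normc_sum _ _ _) _; apply: ler_sum => j _.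
rewrite normcM; apply: le_trans (_ : normc (excess F z j) <= _).
  by rewrite ler_piMr ?normc_ge0 // inv_nat_le1.
exact: (excess_le A1 rhoE rho0 rho1 BE).
Qed.

Lemma prod_euler_factor_log_sum :
  tends (fun N => \prod_(p : {poly_N.+1 F} | monic_irred p) euler_factor z p
    - cexp (log_sum N)) 0.
Proof.
pose C := expR (B / (1 - rho)) * (5 * B * expR (5 * B)).
apply: (@tends_squeeze _ _ _ (fun N => C * rho ^+ N)); first exact: cvg_geometric0.
move=> N; rewrite subr0 -subr_le0.
(* N is fixed while K tends to infinity. *)
have := prod_euler_factor_tends N => /tends_le; apply; first exact: (cvg_cst (0 : R)).
exists N => K NK; rewrite add0r lerBlDl.
apply: le_trans (ler_normc_dist (cexp (log_prod N K)) _ _) _.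
rewrite [leRHS]addrC normcB lerD2l.
have -> : cexp (log_prod N K) - cexp (log_sum N) =
    cexp (log_sum N) * (cexp (log_prod N K - log_sum N) - 1).
  by rewrite mulrBr -cexpD [log_sum N + _]addrC subrK mulr1.
have D := log_prod_sum NK.
have r1 : rho ^+ N <= 1 by rewrite exprn_ile1 // ltW.
have D1 : normc (log_prod N K - log_sum N) <= B.
  by apply: le_trans D _; rewrite ler_piMr.
rewrite normcM /C -[leRHS]mulrA; apply: ler_pM; rewrite ?normc_ge0 //.
  by apply: le_trans (normc_cexp_le _) _; rewrite ler_expR normc_log_sum.
apply: le_trans (cexp_taylor1 _) _.
have -> : 5 * B * expR (5 * B) * rho ^+ N = 5 * (B * rho ^+ N) * expR (5 * B) by ring.
by apply: ler_pM; rewrite ?mulr_ge0 ?normc_ge0 ?expR_ge0 ?ler_expR // ler_wpM2l.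
Qed.

End EulerProduct.

(** * Asymptotics *)

Section AbsolutelySummable.
Variable R : realType.

Lemma geometric_series_tends (g : nat -> R[i]) (C y : R) : 0 < C -> 0 <= y -> y < 1 ->
  (forall k, normc (g k) <= C * y ^+ k) ->
  exists2 G, tends (fun n => \sum_(k < n.+1) g k) G &
    forall n, normc (\sum_(k < n.+1) g k - G) <= C / (1 - y) * y ^+ n.
Proof.
move=> C0 y0 y1 gC; have p : 0 < 1 - y by rewrite subr_gt0.
have D0 : 0 <= C / (1 - y) by rewrite divr_ge0 // ltW.
apply: cauchy_tends => [|m n nm]; first exact: cvg_geometric0.
apply: (@le_trans _ _ (C / (1 - y) * (y ^+ n - y ^+ m))); last first.
  by rewrite ler_wpM2l // lerBlDr lerDl exprn_ge0.
elim: m nm => [|m IH]; first by rewrite leqn0 => /eqP ->; rewrite !subrr normc0 mulr0.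
rewrite leq_eqVlt => /predU1P[<-|nm]; first by rewrite !subrr normc0 mulr0.
rewrite big_ord_recr /= addrAC; apply: le_trans (ler_normcD _ _) _.
apply: le_trans (lerD (IH nm) (gC m.+1)) _.
have -> : C / (1 - y) * (y ^+ n - y ^+ m.+1) =
    C / (1 - y) * (y ^+ n - y ^+ m) + C * y ^+ m.
  by rewrite exprS; field; rewrite gt_eqF.
rewrite lerD2l ler_wpM2l ?(ltW C0) // ler_wiXn2l //; exact: ltW.
Qed.

End AbsolutelySummable.

Section Asymptotics.
Variables (R : realType) (F : finFieldType) (A rho : R) (B : nat).
Implicit Type z : R[i].
Let q := #|F|.
Hypotheses (A1 : 1 <= A) (Aq : A < q%:R) (rhoE : A = (rho ^+ 2) ^+ 2 * q%:R).
Hypotheses (rho0 : 0 <= rho) (rho1 : rho < 1).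
Hypothesis (BE : 2 * q%:R * (1 - rho) ^- 2 <= B%:R).

(** The sequence g of the overview: multiplication by (1 - u)^z cancels the singular factor at u =
    1. *)
Definition cofactor_coef (z : R[i]) : nat -> R[i] :=
  conv (fun n => M F n z * q%:R^-1 ^+ n) (rising (- z)).

Lemma logderiv_normalized_M z :
  logderiv (fun j => posc z j + excess F z j) (fun n => M F n z * q%:R^-1 ^+ n).
Proof.
apply: (eq_logderiv _ _ (logderiv_scale q%:R^-1 (logderiv_M F z))) => // j.
exact: lambda_excess.
Qed.

Lemma logderiv_cofactor_coef z : logderiv (excess F z) (cofactor_coef z).
Proof.
apply: (eq_logderiv _ (frefl _)
  (logderiv_conv (logderiv_normalized_M z) (logderiv_rising (- z)))) => j.
by rewrite /posc mulrN addrAC subrr add0r.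
Qed.

Lemma cofactor_coef0 z : cofactor_coef z 0%N = 1.
Proof. by rewrite /cofactor_coef /conv big_ord1 M0 rising0 expr0 !mulr1. Qed.

Lemma M_cofactor z n :
  M F n z * q%:R^-1 ^+ n = conv (cofactor_coef z) (rising z) n.
Proof.
rewrite /cofactor_coef -convA (@eq_conv _ _ (fun n => M F n z * q%:R^-1 ^+ n) _
  (fun i => (i == 0%N)%:R)) => [|//|i _]; first by rewrite convC conv1l.
by rewrite convC conv_rising_opp.
Qed.

Lemma cofactor_coef_le z k : normc z <= A ->
  normc (cofactor_coef z k) <= k.+1%:R ^+ B * rho ^+ k.
Proof.
move=> zA; apply: (logderiv_geometric_le rho0 (logderiv_cofactor_coef z)).
  exact: cofactor_coef0.
by move=> j; exact: (excess_le A1 rhoE rho0 rho1 BE).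
Qed.

(** The Euler product and the partial sums of g are both asymptotic to [cexp (log_sum F z n)];
    convergence of the latter thus gives that of the product. *)
Lemma H_cofactor_sum z G : normc z <= A ->
  tends (fun n => \sum_(k < n.+1) cofactor_coef z k) G ->
  H F z = inv_Gamma (z + 1) * G.
Proof.
move=> zA TG; rewrite /H; congr (_ * _); apply: clim_tends.
have T1 := prod_euler_factor_log_sum A1 Aq rhoE rho0 rho1 BE zA.
have T2 : tends (fun n => \sum_(k < n.+1) cofactor_coef z k - cexp (log_sum F z n)) 0.
  apply: (sum_logderiv_tends rho0 rho1 (logderiv_cofactor_coef z) (cofactor_coef0 z)).
  by move=> j; exact: (excess_le A1 rhoE rho0 rho1 BE).
pose b n := normc (\prod_(p : {poly_n.+1 F} | monic_irred p) euler_factor z p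
    - cexp (log_sum F z n) - 0)
  + normc (\sum_(k < n.+1) cofactor_coef z k - cexp (log_sum F z n) - 0)
  + normc (\sum_(k < n.+1) cofactor_coef z k - G).
apply: (@tends_squeeze _ _ _ b) => [|n].
  by have T := cvgD (cvgD T1 T2) TG; rewrite !addr0 in T; exact: T.
rewrite /b !subr0.
set P := \prod_(p | _) _; set c := cexp _; set S := \sum_(k < _) _.
rewrite (_ : P - G = (P - c) - (S - c) + (S - G)); last by ring.
apply: le_trans (ler_normcD _ _) _; rewrite lerD2r; exact: ler_normcB.
Qed.

Lemma M_asymptotics : exists C : R, forall (n : nat) z, normc z <= A ->
  normc (cpow n.+1%:R (1 - z) * (M F n.+1 z * q%:R^-1 ^+ n.+1) - z * H F z) <=
    C / n.+1%:R.
Proof.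
(* W = q + 1 since |1 - z| <= 1 + |z|. *)
have [N [C0 [C0_gt0 HC]]] := rising_asymptotics R q.+1.
have [C1 [y [C1_gt0 y0 y1 Hy]]] := poly_geometric_decay (N + B) rho0 rho1.
have p : 0 < 1 - y by rewrite subr_gt0.
have D0 : 0 <= C1 / (1 - y) by rewrite divr_ge0 // ltW.
exists (C0 * (C1 / (1 - y)) + C0 * (C1 / (1 - y) * (1 - y)^-1)) => n z zA.
have zq : normc z <= q%:R := le_trans zA (ltW Aq).
have [||lC Hl] := HC z.
- by apply: le_trans zq _; rewrite ler_nat leqnSn.
- apply: le_trans (ler_normcB _ _) _; rewrite normc1 -natr1 addrC lerD2r.
  exact: zq.
pose g := cofactor_coef z.
have gN k : normc (g k) * k.+1%:R ^+ N <= C1 * y ^+ k.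
  apply: le_trans (Hy k); rewrite exprD mulrC -mulrA ler_wpM2l ?exprn_ge0 //.
  exact: cofactor_coef_le.
have g1 k : normc (g k) <= C1 * y ^+ k.
  by apply: le_trans (gN k); rewrite ler_peMr ?normc_ge0 // exprn_ege1 // ler1n.
have [G TG HG] := geometric_series_tends C1_gt0 y0 y1 g1.
rewrite (H_cofactor_sum zA TG) M_cofactor -/g mulrA.
set l := z * _ in lC Hl *.
(* The error of each shifted coefficient weighted by g, plus l times the tail of the series of g. *)
rewrite (_ : _ - _ = \sum_(k < n.+2) g k * (cpow n.+1%:R (1 - z) * rising z (n.+1 - k) - l)
   + l * (\sum_(k < n.+2) g k - G)); last first.
  rewrite mulrBr addrA; congr (_ - _); rewrite /conv !mulr_sumr -big_split /=.
  by apply: eq_bigr => k _; ring.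
apply: le_trans (ler_normcD _ _) _; rewrite mulrDl; apply: lerD.
  apply: (@le_trans _ _ (\sum_(k < n.+2) C0 * (C1 * y ^+ k) / n.+1%:R)).
    apply: le_trans (ler_normc_sum _ _ _) _; apply: ler_sum => k _.
    rewrite normcM; apply: (@le_trans _ _ (normc (g k) * (C0 * (k.+1%:R ^+ N / n.+1%:R)))).
      by rewrite ler_wpM2l ?normc_ge0 // Hl // -ltnS.
    rewrite mulrCA -mulrA ler_wpM2l ?(ltW C0_gt0) // mulrA ler_wpM2r ?invr_ge0 //.
  rewrite -mulr_suml ler_wpM2r ?invr_ge0 // -mulr_sumr ler_wpM2l //; first exact: ltW.
  by rewrite -mulr_sumr ler_wpM2l ?sum_geometric_le //; exact: ltW.
rewrite normcM -mulrA; apply: ler_pM; rewrite ?normc_ge0 //.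
apply: le_trans (HG n.+1) _; rewrite -[leRHS]mulrA ler_wpM2l //.
rewrite ler_pdivlMr ?ltr0n // mulrC; apply: le_trans (succ_geometric_le n y0 y1).
by rewrite ler_wpM2l // ler_wiXn2l //; exact: ltW.
Qed.

End Asymptotics.

Unset Implicit Arguments.

Theorem proposition1p3 (R : realType) (F : finFieldType)
    (eps : R) (heps : 0 < eps < #|F|%:R) :
  exists C : R, forall (n : nat) (z : R[i]),
    (1 <= n)%N -> `|z| <= (#|F|%:R - eps)%:C ->
    exists E : R[i],
      M F n z = (#|F| ^ n)%:R * cpow n%:R (z - 1) * (z * H F z + E)
      /\ `|E| <= (C / n%:R)%:C.
Proof.
have /andP[eps0 epsq] := heps; have q1 := card_field_gt1 F.
have q0 : 0 < #|F|%:R :> R by rewrite ltr0n ltnW.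
(* q - eps may be below 1, while the bounds on prime powers use A >= 1. *)
pose A : R := Num.max 1 (#|F|%:R - eps).
have A1 : 1 <= A by rewrite le_max lexx.
have Aq : A < #|F|%:R by rewrite gt_max ltr1n q1 ltrBlDr ltrDl.
have s0 : 0 <= A / #|F|%:R by rewrite divr_ge0 ?(le_trans _ A1) // ltW.
have s1 : A / #|F|%:R < 1 by rewrite ltr_pdivrMr // mul1r.
pose rho := Num.sqrt (Num.sqrt (A / #|F|%:R)).
have rho0 : 0 <= rho := sqrtr_ge0 _.
have rho1 : rho < 1 by apply: sqrt_lt1; rewrite ?sqrtr_ge0 // sqrt_lt1.
have rhoE : A = (rho ^+ 2) ^+ 2 * #|F|%:R.
  by rewrite !sqr_sqrtr ?sqrtr_ge0 // divfK // gt_eqF.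
pose B0 : R := 2 * #|F|%:R * (1 - rho) ^- 2.
(* The bound is rounded up to a natural number because it becomes the exponent of k + 1 in
   [cofactor_coef_le]. *)
have [C HC] := @M_asymptotics R F A rho (Num.bound `|B0|) A1 Aq rhoE rho0 rho1
  (le_trans (ler_norm B0) (ltW (archi_boundP (normr_ge0 B0)))).
exists C => -[//|n] z _; rewrite normr_normc lecR => zA.
exists (cpow n.+1%:R (1 - z) * (M F n.+1 z * #|F|%:R^-1 ^+ n.+1) - z * H F z); split.
  rewrite [z * _ + _]addrC subrK; have qn0 : #|F|%:R ^+ n.+1 != 0 :> R[i].
    by rewrite expf_neq0 // pnatr_eq0 -lt0n ltnW.
  have E : cpow n.+1%:R (z - 1) * cpow n.+1%:R (1 - z) = 1 :> R[i].
    by rewrite /cpow -cexpD -mulrDl -opprB addNr mul0r cexp0.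
  rewrite mulrA -(mulrA _ (cpow _ (z - 1))) E mulr1 natrX exprVn mulrCA mulfV //.
  by rewrite mulr1.
rewrite normr_normc lecR; apply: HC; apply: le_trans zA _.
by rewrite le_max lexx orbT.
Qed.
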